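(* Let $n\ge 2$, let $S^n\subset\mathbb{R}^{n+1}$ be the standard unit sphere with its induced metric $g$, and let $\omega$ be the restriction (pullback) to $S^n$ of a differential 2-form on $\mathbb{R}^{n+1}$ whose components in Cartesian coordinates are constants. Let $H:T^*S^n\to\mathbb{R}$, $H(x,p)=\tfrac12\sum_{i,j=1}^n g^{ij}(x)p_ip_j$, and let $\Omega_{\mathrm{pert}}$ be the perturbed symplectic form on $T^*S^n$ determined by $\omega$. Then the magnetic geodesic flow of $(S^n,g,\omega)$, i.e. the Hamiltonian system on $(T^*S^n,\Omega_{\mathrm{pert}})$ with Hamiltonian $H$, is Liouville integrable by means of integrals linear and quadratic in momenta. More specifically, there exist $n$ functions $F_1,\dots,F_n:T^*S^n\to\mathbb{R}$ such that: (1) $H$ is a linear combination of $F_1,\dots,F_n$ with constant coefficients; (2) $F_1,\dots,F_n$ pairwise Poisson-commute with respect to the symplectic form $\Omega_{\mathrm{pert}}$; (3) $F_1,\dots,F_n$ are functionally independent, i.e., their differentials are linearly independent almost everywhere on $T^*S^n$; (4) the first $\lfloor \frac n2\rfloor$ of the functions $F_1,\dots,F_n$ are quadratic in momenta with coefficients depending on the position, and the other $m=n-\lfloor\frac n2\rfloor$ are linear in momenta.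
   Context: In local coordinates $x=(x^1,\dots,x^n)$ on $S^n$ with corresponding momenta $p=(p_1,\dots,p_n)$ on $T^*S^n$, write $\omega=\sum_{i,j}\omega_{ij}(x)\,dx^i\wedge dx^j$. The perturbed symplectic form on $T^*S^n$ is $$\Omega_{\mathrm{pert}}=\sum_{i,j}\omega_{ij}\,dx^i\wedge dx^j+\sum_{i=1}^n dp_i\wedge dx^i,$$ that is, the sum of the pullback of $\omega$ under the projection $T^*S^n\to S^n$ and the canonical form. The matrix $(g^{ij})$ is the inverse of the matrix of the metric $g$. ''Quadratic in momenta'' and ''linear in momenta'' mean polynomial in $p$ of degree two, respectively one, with coefficients that are functions of the position $x$; the polynomials are allowed to be inhomogeneous (they may contain terms of lower degree in $p$). *)

(* Defs.v *)
From HB Require Import structures.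
From mathcomp Require Import all_boot all_order all_algebra.
From mathcomp Require Import all_classical all_reals all_analysis.
From mathcomp Require Import ring.
Set Implicit Arguments.
Unset Strict Implicit.
Unset Printing Implicit Defensive.
Import Order.TTheory GRing.Theory Num.Theory.
Import numFieldNormedType.Exports.
Local Open Scope classical_set_scope.
Local Open Scope ring_scope.

Section tuple_lebesgue.
Variable R : realType.
Local Notation E := (measurableTypeR R).

Definition tuple_cons n (x : E * n.-tuple E) : n.+1.-tuple E :=
  [tuple of x.1 :: x.2].

Lemma measurable_tuple_cons n : measurable_fun setT (@tuple_cons n).
Proof. exact: measurable_cons. Qed.

Section step.
Variables (n : nat) (mu : {sigma_finite_measure set (n.-tuple E) -> \bar R}).

Definition lebesgue_cons : set (n.+1.-tuple E) -> \bar R :=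
  pushforward (lebesgue_measure \x mu)%E (@tuple_cons n).

Let mpre A : measurable A -> measurable (@tuple_cons n @^-1` A).
Proof. by move=> mA; rewrite -[X in measurable X]setTI; exact: measurable_tuple_cons. Qed.

Let lebesgue_cons0 : lebesgue_cons set0 = 0%E.
Proof. by rewrite /lebesgue_cons /pushforward preimage_set0 measure0. Qed.

Let lebesgue_cons_ge0 A : (0 <= lebesgue_cons A)%E.
Proof. by rewrite /lebesgue_cons /pushforward measure_ge0. Qed.

Let lebesgue_cons_sigma_additive : semi_sigma_additive lebesgue_cons.
Proof.
move=> F mF tF mUF; rewrite /lebesgue_cons /pushforward preimage_bigcup.
apply: measure_semi_sigma_additive.
- by move=> k; exact: mpre.
- apply/trivIsetP => /= i j _ _ ij; rewrite -preimage_setI.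
  by move/trivIsetP : tF => /(_ _ _ _ _ ij) ->//; rewrite preimage_set0.
- by rewrite -preimage_bigcup; exact: mpre.
Qed.

HB.instance Definition _ := isMeasure.Build _ _ _ lebesgue_cons
  lebesgue_cons0 lebesgue_cons_ge0 lebesgue_cons_sigma_additive.

Let lebesgue_cons_sigma_finite : sigma_finite setT lebesgue_cons.
Proof.
have /sigma_finiteP[F [FT ndF mF]] := sigma_finiteT (@lebesgue_measure R).
have /sigma_finiteP[G [GT ndG mG]] := sigma_finiteT mu.
pose B k := [set t : n.+1.-tuple E | F k (thead t) /\ G k [tuple of behead t]].
exists B.
  apply/seteqP; split=> // t _.
  have : setT (thead t) by []. rewrite FT => -[i _ Fi].
  have : setT [tuple of behead t] by []. rewrite GT => -[j _ Gj].
  exists (maxn i j) => //; split.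
    by move/subsetPset: (ndF _ _ (leq_maxl i j)); apply.
  by move/subsetPset: (ndG _ _ (leq_maxr i j)); apply.
move=> k; have [mFk Fk] := mF k; have [mGk Gk] := mG k; split.
  rewrite [B k](_ : _ = (@tnth _ E ^~ ord0 @^-1` F k) `&`
     ((fun t : n.+1.-tuple E => [tuple of behead t]) @^-1` G k)) //.
  apply: measurableI; rewrite -[X in measurable X]setTI.
    exact: measurable_tnth.
  exact: measurable_behead.
rewrite /lebesgue_cons /pushforward.
rewrite [X in (_ X < _)%E](_ : _ = F k `*` G k); last first.
  apply/seteqP; split=> -[x t] /=; rewrite /B /= theadE.
    by move=> [Fx Gt]; split=> //=; move: Gt; congr G; apply: val_inj.
  by move=> [Fx Gt]; split=> //=; move: Gt; congr G; apply: val_inj.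
by rewrite product_measure1E// lte_mul_pinfty// ?ge0_fin_numE.
Qed.

HB.instance Definition _ := Measure_isSigmaFinite.Build _ _ _ lebesgue_cons
  lebesgue_cons_sigma_finite.

End step.

Fixpoint lebesgue_tuple n : {sigma_finite_measure set (n.-tuple E) -> \bar R} :=
  if n is k.+1 then lebesgue_cons (lebesgue_tuple k) else \d_ [tuple].

Lemma lebesgue_tuple_box n (a b : 'I_n -> R) : (forall i, a i <= b i) ->
  lebesgue_tuple n [set t | forall i, tnth t i \in `[a i, b i]] =
  (\prod_(i < n) (b i - a i))%:E.
Proof.
elim: n a b => [|n IH] a b ab.
  by rewrite /= /dirac big_ord0 indicE mem_set //=; case.
set B := [set t : n.-tuple E | forall i, tnth t i \in `[a (lift ord0 i), b (lift ord0 i)]].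
have mB : measurable B.
  rewrite [B](_ : _ = \bigcap_(i in [set: 'I_n])
    (@tnth _ E ^~ i @^-1` `[a (lift ord0 i), b (lift ord0 i)]%classic)).
    apply: fin_bigcap_measurable => // i _; rewrite -[X in measurable X]setTI.
    exact: measurable_tnth.
  apply/seteqP; split=> t /=; first by move=> h i _; exact: h.
  by move=> h i; exact: (h i I).
transitivity ((lebesgue_measure \x lebesgue_tuple n)%E
    (`[a ord0, b ord0]%classic `*` B)).
  rewrite /= /lebesgue_cons /pushforward; congr (product_measure1 _ _ _).
  apply/seteqP; split=> -[x t] /=.
    move=> h; split=> [|i]; first exact: (h ord0).
    by have := h (lift ord0 i); rewrite tnthS.
  by move=> [hx ht] i; case: (unliftP ord0 i) => [j|] ->; rewrite ?tnthS //; exact: ht.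
rewrite product_measure1E //= IH; [|by move=> i; exact: ab].
rewrite lebesgue_measure_itv /= lte_fin big_ord_recl EFinM.
have := ab ord0; rewrite le_eqVlt => /predU1P[->|->]; last by rewrite EFinB.
by rewrite ltxx subrr mul0e.
Qed.

End tuple_lebesgue.

Section calculus.
Variables (R : realType) (m : nat).

Fixpoint Ck (k : nat) (f : 'rV[R]_m -> R) : Prop :=
  if k is j.+1 then
    (forall z, differentiable f z) /\ (forall v, Ck j (fun z => 'D_v f z))
  else continuous f.

Definition smooth (f : 'rV[R]_m -> R) : Prop := forall k, Ck k f.

Definition gradient (f : 'rV[R]_m -> R) (z : 'rV[R]_m) : 'rV[R]_m :=
  \row_i 'D_(delta_mx 0 i) f z.

Definition row_of_tuple (t : m.-tuple (measurableTypeR R)) : 'rV[R]_m :=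
  \row_i (tnth t i : R).

End calculus.

Section sphere.
Variables (R : realType) (n : nat).

Definition dotmul m (x y : 'rV[R]_m) : R := (x *m y^T) 0 0.

(* The covector p at the point x is represented by the unique y in R^(n+1)    *)
(* orthogonal to x such that p(v) = <y, v> for all v tangent to S^n at x.     *)
Definition cotangent_sphere : Type :=
  {xy : 'rV[R]_(n + 1) * 'rV[R]_(n + 1) |
    (dotmul xy.1 xy.1 == 1) && (dotmul xy.1 xy.2 == 0)}.

(* Inverse of the stereographic projection of S^n minus (0, ..., 0, (-1)^s);  *)
(* s = false and s = true together give an atlas.                             *)
Definition stereo (s : bool) (u : 'rV[R]_n) : 'rV[R]_(n + 1) :=
  (1 + dotmul u u)^-1 *:
    row_mx (2 *: u) ((-1) ^+ s * (dotmul u u - 1))%:M.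

Definition metric (s : bool) (u : 'rV[R]_n) : 'M[R]_n :=
  'J (stereo s) u *m ('J (stereo s) u)^T.

(* If omega = sum_(a, b) A a b dX^a /\ dX^b on R^(n+1), its pullback by the   *)
(* chart is sum_(i, j) (magnetic A s u) i j du^i /\ du^j.                     *)
Definition magnetic (A : 'M[R]_(n + 1)) (s : bool) (u : 'rV[R]_n) : 'M[R]_n :=
  'J (stereo s) u *m A *m ('J (stereo s) u)^T.

Lemma dotmulE m (x y : 'rV[R]_m) : dotmul x y = \sum_i x 0 i * y 0 i.
Proof. by rewrite /dotmul mxE; apply: eq_bigr => i _; rewrite mxE. Qed.

Lemma dotmulC m (x y : 'rV[R]_m) : dotmul x y = dotmul y x.
Proof. by rewrite !dotmulE; apply: eq_bigr => i _; rewrite mulrC. Qed.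

Lemma dotmulDl m (x y z : 'rV[R]_m) : dotmul (x + y) z = dotmul x z + dotmul y z.
Proof. by rewrite /dotmul mulmxDl mxE. Qed.

Lemma dotmulZl m a (x y : 'rV[R]_m) : dotmul (a *: x) y = a * dotmul x y.
Proof. by rewrite /dotmul -scalemxAl mxE. Qed.

Lemma dotmulDr m (x y z : 'rV[R]_m) : dotmul z (x + y) = dotmul z x + dotmul z y.
Proof. by rewrite !(dotmulC z) dotmulDl. Qed.

Lemma dotmulZr m a (x y : 'rV[R]_m) : dotmul y (a *: x) = a * dotmul y x.
Proof. by rewrite !(dotmulC y) dotmulZl. Qed.

Lemma dotmul_row m1 m2 (x y : 'rV[R]_m1) (x' y' : 'rV[R]_m2) :
  dotmul (row_mx x x') (row_mx y y') = dotmul x y + dotmul x' y'.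
Proof. by rewrite /dotmul tr_row_mx mul_row_col mxE. Qed.

Lemma dotmul_scalar (a b : R) : dotmul (a%:M : 'rV_1) b%:M = a * b.
Proof. by rewrite dotmulE big_ord1 !mxE !mulr1n. Qed.

Lemma dotmul_ge0 m (x : 'rV[R]_m) : 0 <= dotmul x x.
Proof. by rewrite dotmulE sumr_ge0 // => i _; rewrite -expr2 sqr_ge0. Qed.

Lemma stereo_den_neq0 m (u : 'rV[R]_m) : 1 + dotmul u u != 0.
Proof. by rewrite gt_eqF // ltr_wpDr // dotmul_ge0. Qed.

Lemma stereo_sphere s u : dotmul (stereo s u) (stereo s u) = 1.
Proof.
rewrite /stereo dotmulZl dotmulZr dotmul_row dotmul_scalar dotmulZl dotmulZr.
set r := dotmul u u; have := stereo_den_neq0 u; rewrite -/r => r0.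
by have := signrMK s (r - 1); case: s => /= _; field.
Qed.

Lemma is_derive_dotmul m (u v : 'rV[R]_m) :
  is_derive u v (fun w => dotmul w w) (2 * dotmul u v).
Proof.
rewrite (_ : (fun w => _) = \sum_(i < m) (fun w : 'rV[R]_m => w 0 i * w 0 i));
  last by apply/funext => w; rewrite dotmulE fct_sumE.
have D i : is_derive u v (fun w : 'rV[R]_m => w 0 i : R) (v 0 i).
  have d := @differentiable_coord R _ _ u 0 i.
  apply: DeriveDef; first exact: diff_derivable.
  have dv : derivable (id : 'rV[R]_m -> _) u v by [].
  by have := derive_mx dv; rewrite derive_id => /matrixP/(_ 0 i); rewrite mxE.
rewrite dotmulE mulr_sumr.
apply: is_derive_eq.
by apply: eq_bigr => i _; rewrite /GRing.scale /=; ring.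
Qed.

Lemma differentiable_row m k (f : 'rV[R]_m -> 'rV[R]_k) u :
  (forall a, differentiable (fun w => f w 0 a : R) u) -> differentiable f u.
Proof.
move=> df; rewrite (_ : f = \sum_(a < k) (fun w => f w 0 a *: delta_mx 0 a)).
  by apply: differentiable_sum => a; exact: differentiableZl.
by apply/funext => w; rewrite fct_sumE [LHS]row_sum_delta.
Qed.

Lemma is_derive_coord m k (f : 'rV[R]_m -> 'rV[R]_k) u v a :
  derivable f u v -> is_derive u v (fun w => f w 0 a : R) ('D_v f u 0 a).
Proof.
move=> df; apply: DeriveDef; first by move/derivable_mxP : df; exact.
by rewrite derive_mx // mxE.
Qed.

Lemma differentiable_dotmul m (u : 'rV[R]_m) :
  differentiable (fun w => dotmul w w) u.
Proof.
rewrite (_ : (fun w => _) = \sum_(i < m) (fun w : 'rV[R]_m => w 0 i * w 0 i));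
  last by apply/funext => w; rewrite dotmulE fct_sumE.
apply: differentiable_sum => i.
by apply: differentiableM; exact: differentiable_coord.
Qed.

Lemma differentiable_stereo s u : differentiable (stereo s) u.
Proof.
apply: differentiable_row => a.
rewrite (_ : (fun w => _) = (fun w => (1 + dotmul w w)^-1) *
    (fun w => row_mx (2 *: w) ((-1) ^+ s * (dotmul w w - 1))%:M 0 a));
  last by apply/funext => w; rewrite /stereo mxE.
apply: differentiableM.
  apply: differentiableV; last exact: stereo_den_neq0.
  by apply: differentiableD => //; exact: differentiable_dotmul.
case: (split_ordP a) => i ->.
  rewrite (_ : (fun w => _) = 2 *: (fun w : 'rV[R]_n => w 0 i : R)).
    by apply: differentiableZ; exact: differentiable_coord.
  by apply/funext => w; rewrite row_mxEl mxE.
rewrite (_ : (fun w => _) =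
    (-1) ^+ s *: ((fun w : 'rV[R]_n => dotmul w w) - cst 1)).
  apply: differentiableZ; apply: differentiableB => //.
  exact: differentiable_dotmul.
by apply/funext => w; rewrite row_mxEr mxE ord1 eqxx mulr1n.
Qed.

Lemma stereo_jacobian s u v :
  v *m 'J (stereo s) u =
  (1 + dotmul u u)^-1 *: (2 *: row_mx v ((-1) ^+ s * dotmul u v)%:M
                          - (2 * dotmul u v) *: stereo s u).
Proof.
have dS := differentiable_stereo s u.
rewrite -deriveEjacobian //; apply/rowP => a.
have [_ Da] := @is_derive_coord _ _ (stereo s) u v a (diff_derivable dS).
have r0 := stereo_den_neq0 u.
have dr := is_derive_dotmul u v.
pose N (w : 'rV[R]_n) : R :=
  row_mx (2 *: w) ((-1) ^+ s * (dotmul w w - 1))%:M 0 a.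
pose N' : R := (2 *: row_mx v ((-1) ^+ s * dotmul u v)%:M) 0 a.
have dN : is_derive u v N N'.
  rewrite /N /N'; case: (split_ordP a) => i ->.
    rewrite (_ : (fun w => _) = 2 *: (fun w : 'rV[R]_n => w 0 i : R)); last first.
      by apply/funext => w; rewrite row_mxEl mxE.
    rewrite mxE row_mxEl; apply: is_deriveZ.
    have dv : derivable (id : 'rV[R]_n -> _) u v by [].
    by have := is_derive_coord i dv; rewrite derive_id.
  rewrite (_ : (fun w => _) =
      (-1) ^+ s *: ((fun w : 'rV[R]_n => dotmul w w) - cst 1)); last first.
    by apply/funext => w; rewrite row_mxEr mxE ord1 eqxx mulr1n.
  apply: is_derive_eq; rewrite mxE row_mxEr mxE ord1 eqxx mulr1n subr0.
  by rewrite /GRing.scale /= mulrCA.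
have E : (fun w => stereo s w 0 a) = (fun w => (1 + dotmul w w)^-1) * N.
  by apply/funext => w; rewrite /stereo mxE.
rewrite -Da E.
have d1 : is_derive u v (fun w : 'rV[R]_n => 1 + dotmul w w) (2 * dotmul u v).
  apply: is_derive_eq; by rewrite add0r.
have dV : is_derive u v (fun w : 'rV[R]_n => (1 + dotmul w w)^-1)
    (- (1 + dotmul u u) ^- 2 * (2 * dotmul u v)).
  apply: DeriveDef; first by apply: derivableV => //; case: d1.
  by rewrite deriveV //; case: d1 => _ ->.
have -> : 'D_v ((fun w => (1 + dotmul w w)^-1) * N) u =
    (1 + dotmul u u)^-1 * N' + N u * (- (1 + dotmul u u) ^- 2 * (2 * dotmul u v)).
  by have [_ ->] := is_deriveM dV dN.
have G (c d : R) (X Y : 'rV[R]_(n + 1)) :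
  (c *: (X - d *: Y)) 0 a = c * (X 0 a - d * Y 0 a) by rewrite !mxE.
rewrite G -/N' (_ : stereo s u 0 a = (1 + dotmul u u)^-1 * N u).
  by field.
by rewrite /stereo mxE.
Qed.

Lemma metricE s u : metric s u = (4 / (1 + dotmul u u) ^+ 2)%:M.
Proof.
apply/matrixP => i j; set e := fun i : 'I_n => delta_mx 0 i : 'rV[R]_n.
have -> : metric s u i j = dotmul (e i *m 'J (stereo s) u) (e j *m 'J (stereo s) u).
  rewrite /dotmul trmx_mul !mulmxA -(mulmxA (e i)) -/(metric s u)
    -rowE trmx_delta -colE. by rewrite [RHS]mxE [RHS]mxE.
rewrite !stereo_jacobian; set d := 1 + dotmul u u.
have d0 : d != 0 := stereo_den_neq0 u.
have r v : dotmul (stereo s u) (row_mx v ((-1) ^+ s * dotmul u v)%:M) =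
    dotmul u v.
  rewrite /stereo dotmulZl dotmul_row dotmul_scalar dotmulZl.
  have := signrMK s; rewrite -/d (_ : dotmul u u = d - 1); last by rewrite /d; ring.
  by case: s => /= _; field.
have ee : dotmul (e i) (e j) = (i == j)%:R.
  rewrite /dotmul trmx_delta mul_delta_mx_cond.
  by case: (i == j); rewrite ?mulr1n ?mulr0n !mxE ?eqxx.
have rr : dotmul (row_mx (e i) ((-1) ^+ s * dotmul u (e i))%:M)
   (row_mx (e j) ((-1) ^+ s * dotmul u (e j))%:M) =
   (i == j)%:R + dotmul u (e i) * dotmul u (e j).
  by rewrite dotmul_row dotmul_scalar ee; case: s {r} => /=; ring.
have bil (c a b : R) (P Q S : 'rV[R]_(n + 1)) :
  dotmul (c *: (2 *: P - a *: S)) (c *: (2 *: Q - b *: S)) =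
  c ^+ 2 * (4 * dotmul P Q - 2 * b * dotmul S P - 2 * a * dotmul S Q
            + a * b * dotmul S S).
  rewrite -[- (a *: S)]scaleNr -[- (b *: S)]scaleNr (dotmulC S P).
  by rewrite !(dotmulDl, dotmulDr, dotmulZl, dotmulZr); ring.
by rewrite bil rr !r stereo_sphere mxE -mulr_natr; field.
Qed.

Lemma metric_unit s u : metric s u \in unitmx.
Proof.
rewrite metricE unitmxE det_scalar unitrX // unitfE.
by rewrite mulf_neq0 // ?invr_eq0 ?expf_neq0 // stereo_den_neq0.
Qed.

Lemma stereo_tangent s u v : dotmul (stereo s u) (v *m 'J (stereo s) u) = 0.
Proof.
have lin (c a : R) (P S : 'rV[R]_(n + 1)) :
  dotmul S (c *: (2 *: P - a *: S)) = c * (2 * dotmul S P - a * dotmul S S).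
  by rewrite -scaleNr !(dotmulDr, dotmulZr); ring.
rewrite stereo_jacobian lin stereo_sphere.
have r0 := stereo_den_neq0 u.
rewrite /stereo dotmulZl dotmul_row dotmul_scalar dotmulZl.
by have := signrMK s; case: s => /= _; field.
Qed.

Lemma cotangent_chart_proof s (z : 'rV[R]_(n + n)) :
  let x := stereo s (lsubmx z) in
  let y := rsubmx z *m invmx (metric s (lsubmx z)) *m 'J (stereo s) (lsubmx z) in
  (dotmul x x == 1) && (dotmul x y == 0).
Proof. by rewrite /= stereo_sphere stereo_tangent !eqxx. Qed.

(* The chart of the cotangent bundle induced by stereo s: lsubmx z holds the  *)
(* position coordinates u and rsubmx z the momenta p_i = p(d/du^i).           *)
Definition cotangent_chart (s : bool) (z : 'rV[R]_(n + n)) : cotangent_sphere :=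
  exist _ (stereo s (lsubmx z),
    rsubmx z *m invmx (metric s (lsubmx z)) *m 'J (stereo s) (lsubmx z))
    (cotangent_chart_proof s z).

Lemma cotangent_chart_momentum s z i :
  rsubmx z 0 i = dotmul (sval (cotangent_chart s z)).2
    (delta_mx 0 i *m 'J (stereo s) (lsubmx z)).
Proof.
rewrite /= /dotmul trmx_mul mulmxA -(mulmxA _ ('J _ _)).
rewrite -/(metric s (lsubmx z)) mulmxKV ?metric_unit //.
by rewrite trmx_delta -colE [RHS]mxE.
Qed.

Lemma stereo_cover (x : 'rV[R]_(n + 1)) :
  dotmul x x = 1 -> exists s u, stereo s u = x.
Proof.
rewrite -[x]hsubmxK; set a := lsubmx x; set b := rsubmx x 0 0.
have -> : rsubmx x = b%:M by rewrite [LHS]mx11_scalar.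
rewrite dotmul_row dotmul_scalar => ab.
have [s sb] : exists s : bool, 1 - (-1) ^+ s * b != 0.
  have [b1|b1] := eqVneq b 1.
    by exists true; rewrite b1 expr1 mulN1r opprK gt_eqF // ltr_wpDr ?ler01.
  by exists false; rewrite expr0 mul1r subr_eq0 eq_sym.
have e2 : (-1) ^+ s * (-1) ^+ s = 1 :> R by case: s {sb} => /=; ring.
exists s, ((1 - (-1) ^+ s * b)^-1 *: a).
rewrite /stereo dotmulZl dotmulZr.
set e := (-1) ^+ s in sb e2 *; set t := e * b in sb *.
have bt : b = e * t by rewrite /t mulrA e2 mul1r.
have -> : dotmul a a = 1 - t * t.
  by rewrite -ab bt mulrACA e2 mul1r addrK.
have d0 : 1 + (1 - t)^-1 * ((1 - t)^-1 * (1 - t * t)) = 2 * (1 - t)^-1.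
  by field.
rewrite d0 scale_row_mx !scalerA scale_scalar_mx bt.
congr (row_mx _ _%:M); last by field.
by rewrite -[RHS]scale1r; congr (_ *: _); field.
Qed.

Lemma cotangent_chart_cover (xy : cotangent_sphere) :
  exists s z, cotangent_chart s z = xy.
Proof.
case: xy => -[x y] /= xy; have /andP[/eqP xx /eqP xy0] := xy.
have [s [u su]] := stereo_cover xx.
exists s, (row_mx u (y *m ('J (stereo s) u)^T)); apply: val_inj => /=.
rewrite row_mxKl row_mxKr su; congr pair.
set J := 'J (stereo s) u.
apply/eqP; rewrite -subr_eq0; apply/eqP; set w := _ - _.
have wJ : w *m J^T = 0.
  by rewrite mulmxBl -[X in X - _](mulmxA _ J) -/(metric s u) mulmxKV ?metric_unit // subrr.
have wx : dotmul x w = 0.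
  by rewrite -[w]addrC dotmulDr -scaleN1r dotmulZr xy0 -su stereo_tangent; ring.
have wv v : dotmul (v *m J) w = 0.
  by rewrite dotmulC /dotmul trmx_mul mulmxA wJ mul0mx mxE.
have r0 := stereo_den_neq0 u.
move: wx wv; rewrite -su -[w]hsubmxK; set a := lsubmx w; set b := rsubmx w 0 0.
have -> : rsubmx w = b%:M by rewrite [LHS]mx11_scalar.
move=> wx wv.
have wE v : dotmul v a + (-1) ^+ s * dotmul u v * b = 0.
  have := wv v; rewrite stereo_jacobian dotmulZl dotmulDl -scaleNr.
  rewrite (dotmulZl (- _) (stereo s u)) wx mulr0 addr0 dotmulZl dotmul_row.
  rewrite dotmul_scalar => /eqP; rewrite mulf_eq0 invr_eq0 (negPf r0) /=.
  by rewrite mulf_eq0 pnatr_eq0 /= => /eqP.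
have b0 : b = 0.
  move: wx; rewrite /stereo dotmulZl dotmul_row dotmul_scalar dotmulZl => /eqP.
  rewrite mulf_eq0 invr_eq0 (negPf r0) /= => /eqP wx.
  have : (-1) ^+ s * (1 + dotmul u u) * b = 0.
    by have := wE u; move/eqP; rewrite addr_eq0 => /eqP e; move: wx; rewrite e;
       move=> wx; apply/eqP; rewrite -oppr_eq0; apply/eqP; rewrite -[RHS]wx; ring.
  move/eqP; rewrite mulf_eq0 mulf_eq0 signr_eq0 (negPf r0) /=.
  by move/eqP.
suff -> : a = 0 by rewrite b0 raddf0 row_mx0.
apply/rowP => i; have := wE (delta_mx 0 i).
by rewrite b0 mulr0 addr0 dotmulC /dotmul trmx_delta -colE mxE => ->; rewrite mxE.
Qed.

Definition in_chart (F : cotangent_sphere -> R) (s : bool)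
  : 'rV[R]_(n + n) -> R := fun z => F (cotangent_chart s z).

Definition hamiltonian (s : bool) (z : 'rV[R]_(n + n)) : R :=
  2^-1 * \sum_i \sum_j
    invmx (metric s (lsubmx z)) i j * rsubmx z 0 i * rsubmx z 0 j.

(* sum_(i, j) omega_ij du^i /\ du^j + sum_i dp_i /\ du^i at the point z,      *)
(* with the convention (a /\ b)(v, w) = a(v) b(w) - a(w) b(v).                *)
Definition Omega_pert (A : 'M[R]_(n + 1)) (s : bool) (z v w : 'rV[R]_(n + n))
  : R :=
  \sum_i \sum_j magnetic A s (lsubmx z) i j *
    (lsubmx v 0 i * lsubmx w 0 j - lsubmx w 0 i * lsubmx v 0 j)
  + \sum_i (rsubmx v 0 i * lsubmx w 0 i - rsubmx w 0 i * lsubmx v 0 i).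

Definition Omega_mx (A : 'M[R]_(n + 1)) (s : bool) (z : 'rV[R]_(n + n))
  : 'M[R]_(n + n) :=
  \matrix_(i, j) Omega_pert A s z (delta_mx 0 i) (delta_mx 0 j).

(* The vector X with Omega_pert(X, w) = df(w) for all w.                      *)
Definition ham_field (A : 'M[R]_(n + 1)) (s : bool) (f : 'rV[R]_(n + n) -> R)
  (z : 'rV[R]_(n + n)) : 'rV[R]_(n + n) :=
  gradient f z *m invmx (Omega_mx A s z).

Definition poisson (A : 'M[R]_(n + 1)) (s : bool)
  (f h : 'rV[R]_(n + n) -> R) (z : 'rV[R]_(n + n)) : R :=
  Omega_pert A s z (ham_field A s f z) (ham_field A s h z).

Definition linear_in_momenta (f : 'rV[R]_(n + n) -> R) : Prop :=
  exists (b : 'rV[R]_n -> 'I_n -> R) (c : 'rV[R]_n -> R),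
    (forall u p, f (row_mx u p) = \sum_i b u i * p 0 i + c u) /\
    (exists u (p : 'rV[R]_n), \sum_i b u i * p 0 i != 0).

Definition quadratic_in_momenta (f : 'rV[R]_(n + n) -> R) : Prop :=
  exists (a : 'rV[R]_n -> 'I_n -> 'I_n -> R) (b : 'rV[R]_n -> 'I_n -> R)
    (c : 'rV[R]_n -> R),
    (forall u p, f (row_mx u p) =
       \sum_i \sum_j a u i j * p 0 i * p 0 j + \sum_i b u i * p 0 i + c u) /\
    (exists u (p : 'rV[R]_n), \sum_i \sum_j a u i j * p 0 i * p 0 j != 0).

Lemma Omega_mxE A s z v w :
  Omega_pert A s z v w = (v *m Omega_mx A s z *m w^T) 0 0.
Proof.
pose W := magnetic A s (lsubmx z).
pose M : 'M[R]_(n + n) := block_mx (W - W^T) (- 1%:M) 1%:M 0.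
have ME v' w' : Omega_pert A s z v' w' = (v' *m M *m w'^T) 0 0.
  rewrite -[in RHS](hsubmxK v') -[in RHS](hsubmxK w') mul_row_block tr_row_mx.
  rewrite mul_row_col mulmx1 mulmxN mulmx1 mulmx0 addr0 mulmxDl mulmxBr mulmxBl.
  rewrite /Omega_pert -/W.
  set a := lsubmx v'; set b := lsubmx w'; set p := rsubmx v'; set q := rsubmx w'.
  have bil (N : 'M[R]_n) (x y : 'rV[R]_n) :
    (x *m N *m y^T) 0 0 = \sum_i \sum_j N i j * (x 0 i * y 0 j).
    rewrite mxE; under eq_bigr do rewrite !mxE mulr_suml.
    rewrite exchange_big; apply: eq_bigr => i _; apply: eq_bigr => j _ /=.
    by rewrite mulrCA mulrA.
  have lin (x y : 'rV[R]_n) : (x *m y^T) 0 0 = \sum_i x 0 i * y 0 i.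
    exact: dotmulE.
  have E (X Y Z T : 'M[R]_1) :
    (X - Y + Z + T) 0 0 = X 0 0 - Y 0 0 + Z 0 0 + T 0 0 by rewrite !mxE.
  have neg (X : 'M[R]_1) : (- X) 0 0 = - X 0 0 by rewrite mxE.
  rewrite E !bil mulNmx neg !lin.
  have -> : \sum_i \sum_j W^T i j * (a 0 i * b 0 j) =
      \sum_i \sum_j W i j * (b 0 i * a 0 j).
    rewrite exchange_big; apply: eq_bigr => i _; apply: eq_bigr => j _.
    by rewrite mxE (mulrC (a 0 j)).
  rewrite -sumrB -addrA; congr (_ + _).
    apply: eq_bigr => i _; rewrite -sumrB; apply: eq_bigr => j _.
    by rewrite mulrBr.
  rewrite sumrB; congr (_ - _).
  by apply: eq_bigr => i _; rewrite mulrC.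
rewrite ME; congr ((_ *m _ *m _) 0 0); apply/matrixP => i j.
by rewrite [RHS]mxE ME trmx_delta -rowE -colE !mxE.
Qed.

Lemma Omega_mx_unit A s z : Omega_mx A s z \in unitmx.
Proof.
rewrite -row_free_unit -kermx_eq0; apply/rowV0P => v /sub_kermxP vM.
have v0 w : Omega_pert A s z v w = 0 by rewrite Omega_mxE vM mul0mx mxE.
have l0 : lsubmx v = 0.
  apply/rowP => k; have := v0 (row_mx 0 (delta_mx 0 k)).
  rewrite /Omega_pert row_mxKl row_mxKr big1 => [|i _]; last first.
    by rewrite big1 // => j _; rewrite !mxE mulr0 mul0r subrr mulr0.
  rewrite add0r (bigD1 k) //= big1 => [|i ik]; last first.
    by rewrite !mxE (negPf ik) andbF mulr0 mul0r subrr.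
  rewrite addr0 !mxE !eqxx mulr0 mul1r sub0r => /eqP.
  by rewrite oppr_eq0 => /eqP.
have r0 : rsubmx v = 0.
  apply/rowP => k; have := v0 (row_mx (delta_mx 0 k) 0).
  rewrite /Omega_pert row_mxKl row_mxKr l0 big1 => [|i _]; last first.
    by rewrite big1 // => j _; rewrite !mxE mulr0 mul0r subrr mulr0.
  rewrite add0r (bigD1 k) //= big1 => [|i ik]; last first.
    by rewrite !mxE (negPf ik) andbF mulr0 mul0r subrr.
  by rewrite addr0 !mxE !eqxx mulr0 subr0 mulr1.
by rewrite -[v]hsubmxK l0 r0 row_mx0.
Qed.

Lemma ham_fieldP A s f z w :
  Omega_pert A s z (ham_field A s f z) w = (gradient f z *m w^T) 0 0.
Proof. by rewrite Omega_mxE mulmxKV // Omega_mx_unit. Qed.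

End sphere.

(* Main.v *)
Require Import Defs.
From mathcomp Require Import all_boot all_order all_algebra.
From mathcomp Require Import all_classical all_reals all_analysis.
From mathcomp Require Import measurable_realfun ring lra zify.

(** The magnetic form is exact: it is the differential of the one-form
[v |-> dotmul (x *m A) v]. Shifting the covector [y] by [x *m A] therefore turns
the twisted symplectic form into the canonical one: the map
(x, y) |-> (x, y + xA) into the ambient space pulls the canonical form back to
[Omega_pert] ([Omega_pert_pullback]). Consequently the bracket of functions of
position and shifted momentum is the canonical ambient bracket, provided that they
do not depend on the normal part of the momentum ([poisson_embedding]).

In terms of the shifted momentum the kinetic energy acquires a rotation and a
potential |xA|^2 / 2. Choose an orthonormal frame in which [A] is a sum of planar
rotations with speeds [lam a] ([skew_normal_form]). Then the hamiltonian is the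
energy of the Neumann system with potential coefficients [lam a ^+ 2], equal in
the two directions of a plane, minus a combination of the angular momenta of the
planes ([kinetic_energy_integral]). These angular momenta are the linear integrals.
They generate symmetries of the Neumann system and of its quadratic Uhlenbeck
integrals, whose coefficients are divided differences with respect to the numbers
[lam a ^+ 2] ([integral_bracket]). There are as many planes as required linear
integrals, and the Uhlenbeck integrals, one per block of coordinates, satisfy one
relation, which leaves the required number of quadratic ones.

When some of the speeds coincide up to sign, Uhlenbeck integrals degenerate. They
are replaced by their limits under a splitting of the coinciding values
([two_level_quotient]), which keeps both commutation and their number. The
hamiltonian itself is taken as the first quadratic integral.

For independence it is enough to look at derivatives along the momenta at one point
of each chart. There the gradients of the linear integrals live in odd coordinates
and those of the quadratic ones in even coordinates, and a relation between the
latter contradicts positivity of a sum of squares ([momentum_gradient_kernel]). All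
functions are rational without poles in the charts, so a Gram determinant that is
nonzero somewhere is nonzero almost everywhere ([pole_free_row_free_ae]). *)

Set Implicit Arguments.
Unset Strict Implicit.
Unset Printing Implicit Defensive.
Import Order.TTheory GRing.Theory Num.Theory.
Import numFieldNormedType.Exports.
Local Open Scope classical_set_scope.
Local Open Scope ring_scope.

(** * Rational functions without poles *)

Section pole_free.
Variable R : realType.

(** Rational functions that are defined on the whole space, generated so that all
closure properties are proved by induction. The chart expressions of the
integrals belong to this class, and so do their derivatives and the Gram
determinants of their differentials. *)
Inductive pole_free m : ('rV[R]_m -> R) -> Prop :=
| pole_free_cst c : pole_free (fun=> c)
| pole_free_coord i : pole_free (fun z => z 0 i)
| pole_freeD f g : pole_free f -> pole_free g -> pole_free (fun z => f z + g z)
| pole_freeM f g : pole_free f -> pole_free g -> pole_free (fun z => f z * g z)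
| pole_freeV f : pole_free f -> (forall z, f z != 0) ->
    pole_free (fun z => (f z)^-1).

Section closure.
Variable m : nat.
Implicit Types f g : 'rV[R]_m -> R.

Lemma pole_freeN f : pole_free f -> pole_free (fun z => - f z).
Proof.
move=> rf; under eq_fun do rewrite -mulN1r.
by apply: pole_freeM => //; exact: pole_free_cst.
Qed.

Lemma pole_free_sum (I : Type) (r : seq I) (P : pred I) (f : I -> 'rV[R]_m -> R) :
  (forall i, pole_free (f i)) -> pole_free (fun z => \sum_(i <- r | P i) f i z).
Proof.
move=> rf; elim: r => [|i r IH].
  by under eq_fun do rewrite big_nil; exact: pole_free_cst.
under eq_fun do rewrite big_cons; case: (P i) => //.
exact: pole_freeD.
Qed.

Lemma pole_free_prod (I : Type) (r : seq I) (P : pred I) (f : I -> 'rV[R]_m -> R) :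
  (forall i, pole_free (f i)) -> pole_free (fun z => \prod_(i <- r | P i) f i z).
Proof.
move=> rf; elim: r => [|i r IH].
  by under eq_fun do rewrite big_nil; exact: pole_free_cst.
under eq_fun do rewrite big_cons; case: (P i) => //.
exact: pole_freeM.
Qed.

Lemma pole_free_det k (M : 'rV[R]_m -> 'M[R]_k) :
  (forall i j, pole_free (fun z => M z i j)) -> pole_free (fun z => \det (M z)).
Proof.
move=> rM; rewrite /determinant; apply: pole_free_sum => s.
by apply: pole_freeM; [exact: pole_free_cst|exact: pole_free_prod].
Qed.

End closure.

Lemma pole_free_comp m k (f : 'rV[R]_m -> R) (g : 'rV[R]_k -> 'rV[R]_m) :
  pole_free f -> (forall i, pole_free (fun z => g z 0 i)) ->
  pole_free (fun z => f (g z)).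
Proof.
move=> rf rg; elim: rf => {f}.
- by move=> c; exact: pole_free_cst.
- by move=> i; exact: rg.
- by move=> f h _ ? _ ?; exact: pole_freeD.
- by move=> f h _ ? _ ?; exact: pole_freeM.
- by move=> f _ ? f0; exact: pole_freeV.
Qed.

Section derivatives.
Variable m : nat.
Implicit Types f g : 'rV[R]_m -> R.

Lemma is_derive_mul f g z v df dg : is_derive z v f df -> is_derive z v g dg ->
  is_derive z v (fun w => f w * g w) (df * g z + f z * dg).
Proof.
move=> Df Dg; apply: (is_derive_eq (is_deriveM Df Dg)).
by rewrite /GRing.scale /= addrC (mulrC df).
Qed.

Lemma is_derive_inv f z v df : f z != 0 -> is_derive z v f df ->
  is_derive z v (fun w => (f w)^-1) (- df * (f z)^-1 * (f z)^-1).
Proof.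
move=> f0 [df1 dfE]; apply: DeriveDef; first exact: derivableV.
by rewrite deriveV // dfE /GRing.scale /= -exprVn; ring.
Qed.

Lemma is_deriveE f z v df : is_derive z v f df -> 'D_v f z = df.
Proof. by move=> Df; rewrite derive_val. Qed.

Lemma pole_free_differentiable f : pole_free f -> forall z, differentiable f z.
Proof.
elim=> {f}.
- by move=> c z; exact: differentiable_cst.
- by move=> i z; exact: differentiable_coord.
- by move=> f g _ df _ dg z; exact: differentiableD.
- by move=> f g _ df _ dg z; exact: differentiableM.
- by move=> f _ df f0 z; exact: differentiableV.
Qed.

Lemma pole_free_is_derive f z v : pole_free f -> is_derive z v f ('D_v f z).
Proof.
by move=> rf; apply: DeriveDef => //; apply: diff_derivable;
  exact: pole_free_differentiable.
Qed.

Lemma derive_coord (z v : 'rV[R]_m) i : 'D_v (fun w : 'rV[R]_m => w 0 i : R) z = v 0 i.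
Proof.
have dv : derivable (id : 'rV[R]_m -> _) z v by [].
by have [_ ->] := is_derive_coord i dv; rewrite derive_id.
Qed.

Lemma pole_free_derive f : pole_free f -> forall v, pole_free (fun z => 'D_v f z).
Proof.
move=> rf v; elim: rf => {f}.
- by move=> c; under eq_fun do rewrite derive_cst; exact: pole_free_cst.
- by move=> i; under eq_fun do rewrite derive_coord; exact: pole_free_cst.
- move=> f g rf ? rg ?.
  under eq_fun => z do rewrite (is_deriveE (is_deriveD
    (pole_free_is_derive z v rf) (pole_free_is_derive z v rg))).
  exact: pole_freeD.
- move=> f g rf ? rg ?.
  under eq_fun => z do rewrite (is_deriveE (is_derive_mul
    (pole_free_is_derive z v rf) (pole_free_is_derive z v rg))).
  by apply: pole_freeD; exact: pole_freeM.
- move=> f rf ? f0.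
  under eq_fun => z do rewrite (is_deriveE (is_derive_inv (f0 z)
    (pole_free_is_derive z v rf))).
  have rV := pole_freeV rf f0.
  by do 2 apply: pole_freeM => //; exact: pole_freeN.
Qed.

Lemma pole_free_smooth f : pole_free f -> smooth f.
Proof.
move=> + k; elim: k f => [|k IH] f rf /=.
  by move=> z; apply: differentiable_continuous; exact: pole_free_differentiable.
split; first exact: pole_free_differentiable.
by move=> v; apply: IH; exact: pole_free_derive.
Qed.

(** The class is closed under derivation, so equality of mixed partials needs no
limit argument: it propagates through the generating operations. *)
Lemma pole_free_schwarz f : pole_free f -> forall a b z,
  'D_a (fun z => 'D_b f z) z = 'D_b (fun z => 'D_a f z) z.
Proof.
move=> rf a b; elim: rf => {f}.
- move=> k z; have E c : (fun z => 'D_c (fun=> k) z) = cst 0 :> ('rV[R]_m -> R).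
    by apply/funext => w; rewrite derive_cst.
  by rewrite !E !derive_cst.
- move=> i z; have E c : (fun z => 'D_c (fun z : 'rV[R]_m => z 0 i : R) z) = cst (c 0 i).
    by apply/funext => w; rewrite derive_coord.
  by rewrite !E !derive_cst.
- move=> f g rf IHf rg IHg z.
  have E c : (fun z => 'D_c (fun z => f z + g z) z) =
      (fun z => 'D_c f z + 'D_c g z).
    apply/funext => w; exact: (is_deriveE (is_deriveD
      (pole_free_is_derive w c rf) (pole_free_is_derive w c rg))).
  have D c d := pole_free_is_derive z c (pole_free_derive rf d).
  have D' c d := pole_free_is_derive z c (pole_free_derive rg d).
  rewrite !E (is_deriveE (is_deriveD (D a b) (D' a b))).
  by rewrite (is_deriveE (is_deriveD (D b a) (D' b a))) IHf IHg.
- move=> f g rf IHf rg IHg z.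
  have E c : (fun z => 'D_c (fun z => f z * g z) z) =
      (fun z => 'D_c f z * g z + f z * 'D_c g z).
    apply/funext => w; exact: (is_deriveE (is_derive_mul
      (pole_free_is_derive w c rf) (pole_free_is_derive w c rg))).
  have D c := pole_free_is_derive z c rf.
  have D' c := pole_free_is_derive z c rg.
  have DD c d := pole_free_is_derive z c (pole_free_derive rf d).
  have DD' c d := pole_free_is_derive z c (pole_free_derive rg d).
  have F c d := is_deriveE (is_deriveD (is_derive_mul (DD c d) (D' c))
    (is_derive_mul (D c) (DD' c d))).
  rewrite !E F F IHf IHg /=.
  move: ('D_b ('D_a f) z) ('D_b ('D_a g) z) ('D_a f z) ('D_b f z) ('D_a g z).
  by move: ('D_b g z) (f z) (g z); clear => *; ring.
- move=> f rf IHf f0 z.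
  have E c : (fun z => 'D_c (fun z => (f z)^-1) z) =
      (fun z => - 'D_c f z * (f z)^-1 * (f z)^-1).
    apply/funext => w; exact: (is_deriveE (is_derive_inv (f0 w)
      (pole_free_is_derive w c rf))).
  have D c := pole_free_is_derive z c rf.
  have DD c d := pole_free_is_derive z c (pole_free_derive rf d).
  have I c := is_derive_inv (f0 z) (D c).
  have F c d := is_deriveE (is_derive_mul (is_derive_mul
    (is_deriveN (DD c d)) (I c)) (I c)).
  have N c : (- 'D_c f) z = - 'D_c f z by [].
  rewrite !E F F IHf !N /=.
  move: ('D_b ('D_a f) z) ('D_a f z) ('D_b f z) ((f z)^-1).
  by clear => *; ring.
Qed.

End derivatives.

End pole_free.

(** * Zero sets of rational functions are null *)

Section null_sets.
Variable R : realType.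

(** On a line such a function is a quotient of polynomials, so it has finitely many
zeros unless it vanishes identically. *)
Lemma pole_free_line m (f : 'rV[R]_m -> R) (a b : 'rV[R]_m) : pole_free f ->
  exists p q : {poly R}, (forall t, q.[t] != 0) /\
    forall t, f (a + t *: b) = p.[t] / q.[t].
Proof.
elim=> {f}.
- by move=> c; exists c%:P, 1; split=> t; rewrite !hornerE ?oner_neq0 ?divr1.
- move=> i; exists ((a 0 i)%:P + 'X * (b 0 i)%:P), 1.
  by split=> t; rewrite !hornerE ?oner_neq0 ?invr1 ?mulr1 // !mxE.
- move=> f g _ [p [q [q0 pq]]] _ [p' [q' [q0' pq']]].
  exists (p * q' + p' * q), (q * q'); split=> t; rewrite !hornerE.
    by rewrite mulf_neq0.
  by rewrite pq pq'; field; rewrite q0 q0'.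
- move=> f g _ [p [q [q0 pq]]] _ [p' [q' [q0' pq']]].
  exists (p * p'), (q * q'); split=> t; rewrite !hornerE.
    by rewrite mulf_neq0.
  by rewrite pq pq'; field; rewrite q0 q0'.
- move=> f _ [p [q [q0 pq]]] f0; exists q, p.
  have p0 t : p.[t] != 0.
    by apply: contraNneq (f0 (a + t *: b)) => e; rewrite pq e mul0r.
  by split=> // t; rewrite pq invf_div.
Qed.

Lemma pole_free_measurable m (f : 'rV[R]_m -> R) : pole_free f ->
  measurable_fun setT (fun t : m.-tuple (measurableTypeR R) => f (row_of_tuple t)).
Proof.
elim=> {f}.
- by move=> c; exact: measurable_cst.
- move=> i; under eq_fun do rewrite mxE; exact: measurable_tnth.
- by move=> f g _ mf _ mg; exact: measurable_funD.
- by move=> f g _ mf _ mg; exact: measurable_funM.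
- move=> f _ mf f0.
  apply: (@measurable_comp _ _ _ _ _ _ [set x : R | x != 0] (@GRing.inv R)) => //.
  + by apply: open_measurable; exact: open_neq.
  + by move=> _ [t _ <-] /=.
  + apply: open_continuous_measurable_fun; first exact: open_neq.
    by move=> x; rewrite inE /= => x0; exact: inv_continuous.
Qed.

Lemma row_of_tuple_cons m (x : R) (t : m.-tuple (measurableTypeR R)) :
  row_of_tuple (tuple_cons (x, t)) = row_mx (x%:M : 'M[R]_1) (row_of_tuple t).
Proof.
apply/rowP => i; rewrite !mxE; case: splitP => j ij; rewrite !mxE.
  rewrite ord1 eqxx mulr1n (_ : i = ord0) ?tnth0 //.
  by apply: val_inj; rewrite /= ij ord1.
by rewrite (_ : i = lift ord0 j) ?tnthS //; apply: val_inj; rewrite /= ij.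
Qed.

(** By Fubini and induction on the dimension: if [f z0 != 0], then on the line
through [z0] in the first coordinate direction only finitely many points are
zeros, and every other slice orthogonal to that direction has a null zero set. *)
Lemma pole_free_null m (f : 'rV[R]_m -> R) z0 : pole_free f -> f z0 != 0 ->
  lebesgue_tuple R m [set t | f (row_of_tuple t) = 0] = 0%E.
Proof.
elim: m f z0 => [|m IH] f z0 rf fz0.
  rewrite /= /dirac indicE memNset //= => f0; move/negP: fz0; apply; apply/eqP.
  by rewrite -f0; congr f; apply/rowP => -[].
set Z := [set t | _].
have mZ : measurable Z.
  rewrite [Z](_ : _ = (fun t => f (row_of_tuple t)) @^-1` [set 0]) //.
  by rewrite -[X in measurable X]setTI; exact: pole_free_measurable.
have mpre : measurable (@tuple_cons R m @^-1` Z).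
  by rewrite -[X in measurable X]setTI; exact: measurable_tuple_cons.
rewrite /= /lebesgue_cons /pushforward /= /product_measure1.
pose x0 := lsubmx (z0 : 'rV_(1 + m)) 0 0; pose y0 := rsubmx (z0 : 'rV_(1 + m)).
have z0E : z0 = row_mx x0%:M y0 by rewrite -mx11_scalar hsubmxK.
have [p [q [q0 pq]]] :=
  pole_free_line (row_mx 0 y0) (row_mx (1%:M : 'M[R]_1) 0) rf.
have lineE x : f (row_mx x%:M y0) = p.[x] / q.[x].
  rewrite -pq; congr f.
  by rewrite scale_row_mx add_row_mx scaler0 addr0 add0r scale_scalar_mx mulr1.
have p0 : p != 0.
  by apply: contraNneq fz0 => p0; rewrite z0E lineE p0 horner0 mul0r.
pose N : set (measurableTypeR R) := [set x | root p x].
(* Splitting off roots one at a time bounds the number of roots by the degree. *)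
have finN : finite_set N.
  have [r Nr] : exists r : seq R, forall x, N x -> x \in r.
    have : exists n, (size p <= n)%N by exists (size p).
    move=> [k]; clear - p0; move: @N => /=.
    elim: k p p0 => [|k IHk] p p0 pk; first by rewrite leqn0 size_poly_eq0 (negPf p0) in pk.
    have [[x rx]|nr] := pselect (exists x, root p x); last first.
      by exists [::] => x rx; exfalso; apply: nr; exists x.
    have /factor_theorem [g pg] := rx.
    have g0 : g != 0 by apply: contra_neq p0 => g0; rewrite pg g0 mul0r.
    have [|r gr] := IHk g g0.
      by rewrite -ltnS (leq_trans _ pk) // pg size_mul ?polyXsubC_eq0 // size_XsubC addn2.
    exists (x :: r) => y /=; rewrite pg rootM root_XsubC inE => /orP[/gr ->|->//].
    by rewrite orbT.
  by apply: (sub_finite_set _ (finite_seq r)) => x /Nr.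
have N0 : lebesgue_measure N = 0%E.
  by apply: countable_lebesgue_measure0; exact: finite_set_countable.
apply/eqP; rewrite eq_le integral_ge0 ?andbT; last by move=> x _ /=.
rewrite (@ge0_negligible_integral _ _ _ _ _ N) //=.
- rewrite integral0_eq // => x [_ Nx].
  have E : xsection (@tuple_cons R m @^-1` Z) x =
      [set t | f (row_mx (x%:M : 'M[R]_1) (row_of_tuple t)) = 0].
    by apply/seteqP; split=> t; rewrite /xsection /= inE /Z /= -row_of_tuple_cons.
  rewrite /= E; apply: (IH (fun y => f (row_mx x%:M y)) y0).
  + apply: pole_free_comp rf _ => i.
    pose h (z : 'rV[R]_m) : R := match fintype.split (i : 'I_(1 + m)) with
       | inl _ => x | inr j => z 0 j end.
    rewrite [X in pole_free X](_ : _ = h).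
      by rewrite /h; case: (fintype.split _) => j; [exact: pole_free_cst|exact: pole_free_coord].
    apply/funext => z; rewrite /h mxE; case: (fintype.split _) => // j.
    by rewrite ord1 mxE eqxx mulr1n.
  + by rewrite lineE mulf_neq0 ?invr_eq0 //; apply/negP.
- apply: countable_measurable; last exact: finite_set_countable.
  by move=> x; exact: measurable_set1.
- exact: measurable_fun_xsection.
Qed.

End null_sets.

(** * Invariant planes of a skew matrix *)

Section skew_normal_form.
Variables (R : realType) (N : nat).
Implicit Types (x y w : 'rV[R]_N) (v : nat -> 'rV[R]_N).

Lemma dotmul_eq0 m (x : 'rV[R]_m) : dotmul x x = 0 -> x = 0.
Proof.
rewrite dotmulE => /eqP; rewrite psumr_eq0 => [/allP xx|i _]; last first.
  by rewrite -expr2 sqr_ge0.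
apply/rowP => i; rewrite mxE; apply/eqP.
by have := xx i (mem_index_enum _); rewrite -expr2 sqrf_eq0.
Qed.

Lemma dotmul0 m (x : 'rV[R]_m) : dotmul x 0 = 0.
Proof. by rewrite dotmulC /dotmul mul0mx mxE. Qed.

Lemma dotmulNr m (x y : 'rV[R]_m) : dotmul x (- y) = - dotmul x y.
Proof. by rewrite -scaleN1r dotmulZr mulN1r. Qed.

Lemma dotmul_mulmx m k (x : 'rV[R]_m) (y : 'rV[R]_k) (B : 'M[R]_(m, k)) :
  dotmul (x *m B) y = dotmul x (y *m B^T).
Proof. by rewrite /dotmul trmx_mul trmxK mulmxA. Qed.

Lemma pole_free_dotmul m k (f g : 'rV[R]_m -> 'rV[R]_k) :
  (forall i, pole_free (fun z => f z 0 i)) ->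
  (forall i, pole_free (fun z => g z 0 i)) ->
  pole_free (fun z => dotmul (f z) (g z)).
Proof.
move=> rf rg; under eq_fun do rewrite dotmulE.
by apply: pole_free_sum => i; exact: pole_freeM.
Qed.

Lemma pole_free_mulmx m k l (f : 'rV[R]_m -> 'rV[R]_k) (B : 'M[R]_(k, l)) :
  (forall i, pole_free (fun z => f z 0 i)) ->
  forall j, pole_free (fun z => (f z *m B) 0 j).
Proof.
move=> rf j; under eq_fun do rewrite mxE.
by apply: pole_free_sum => i; apply: pole_freeM => //; exact: pole_free_cst.
Qed.

Lemma pole_free_continuous m (f : 'rV[R]_m -> R) : pole_free f -> continuous f.
Proof.
by move=> rf z; apply: differentiable_continuous; exact: pole_free_differentiable.
Qed.

Lemma exists_orthogonal_unit v k : (k < N)%N ->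
  exists w, dotmul w w = 1 /\ forall i, (i < k)%N -> dotmul w (v i) = 0.
Proof.
move=> kN; pose V : 'M[R]_(k, N) := \matrix_(i < k) v i.
have : kermx V^T != 0.
  rewrite -mxrank_eq0 mxrank_ker -lt0n subn_gt0.
  by apply: leq_ltn_trans kN; exact: rank_leq_col.
case/rowV0Pn => w /sub_kermxP wV w0.
have ww : 0 < dotmul w w.
  by rewrite lt_def dotmul_ge0 andbT; apply: contra_neq w0 => /dotmul_eq0.
exists ((Num.sqrt (dotmul w w))^-1 *: w); split=> [|i ik].
  rewrite dotmulZl dotmulZr mulrA -expr2 exprVn sqr_sqrtr ?dotmul_ge0 //.
  by rewrite mulVf // gt_eqF.
rewrite dotmulZl; have /rowP/(_ (Ordinal ik)) := wV.
have -> : (w *m V^T) 0 (Ordinal ik) = dotmul w (v i).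
  by rewrite dotmulE mxE; apply: eq_bigr => j _; rewrite !mxE.
by rewrite mxE => ->; rewrite mulr0.
Qed.

Definition orthonormal_upto v k :=
  forall i j, (i < k)%N -> (j < k)%N -> dotmul (v i) (v j) = (i == j)%:R.

(** The unit sphere in the orthogonal complement of finitely many vectors is
compact. *)
Lemma maximal_unit (A : 'M[R]_N) v k : (k < N)%N ->
  exists x, [/\ dotmul x x = 1, forall i, (i < k)%N -> dotmul x (v i) = 0 &
    forall w, (forall i, (i < k)%N -> dotmul w (v i) = 0) ->
      dotmul (w *m A) (w *m A) <= dotmul (x *m A) (x *m A) * dotmul w w].
Proof.
move=> kN; pose S := [set x : 'rV[R]_N |
  dotmul x x = 1 /\ forall i, (i < k)%N -> dotmul x (v i) = 0].
have rid i : pole_free (fun x : 'rV[R]_N => x 0 i) by exact: pole_free_coord.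
have cdot (y : 'rV[R]_N) : continuous (fun x : 'rV[R]_N => dotmul x y).
  apply: pole_free_continuous; apply: pole_free_dotmul => // i.
  exact: pole_free_cst.
have cS : compact S.
  apply: bounded_closed_compact.
    exists 1; split=> // M M1 x [xx _] /=.
    rewrite [leLHS](_ : _ = mx_norm x) // mx_normrE; apply/bigmax_leP; split=> [|[i j] _] /=.
      by rewrite (le_trans _ (ltW M1)).
    apply: le_trans (ltW M1); rewrite -(@ler_pXn2r _ 2) ?nnegrE //.
    rewrite expr1n real_normK ?num_real // -xx dotmulE ord1 (bigD1 j) //=.
    rewrite -expr2 lerDl sumr_ge0 // => l _.
    by rewrite -expr2 sqr_ge0.
  have -> : S = (fun x => dotmul x x) @^-1` [set 1] `&`
     \bigcap_(i in [set i | (i < k)%N]) (fun x => dotmul x (v i)) @^-1` [set 0].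
    by apply/seteqP; split=> x [].
  apply: closedI.
    apply: preimage_closed; last exact: closed_eq.
    by move=> x _; apply: pole_free_continuous; exact: pole_free_dotmul.
  apply: closed_bigI => i _.
  apply: preimage_closed; last exact: closed_eq.
  by move=> x _; exact: cdot.
have [x0 [x0x0 x0v]] := exists_orthogonal_unit v kN.
have S0 : S !=set0 by exists x0.
have cf : {within S, continuous (fun x => dotmul (x *m A) (x *m A))}.
  apply: continuous_subspaceT; apply: pole_free_continuous.
  by apply: pole_free_dotmul; exact: pole_free_mulmx.
have [x /set_mem[xx xv] xmax] := EVT_max_rV S0 cS cf.
exists x; split=> // w wv.
have [->|w0] := eqVneq w 0; first by rewrite mul0mx !dotmul0 mulr0.
have ww : 0 < dotmul w w.
  by rewrite lt_def dotmul_ge0 andbT; apply: contra_neq w0 => /dotmul_eq0.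
have := xmax ((Num.sqrt (dotmul w w))^-1 *: w).
rewrite -scalemxAl !dotmulZl !dotmulZr !mulrA -!expr2 exprVn sqr_sqrtr ?dotmul_ge0 //.
rewrite mulrC ler_pdivrMr //; apply; apply/mem_set; split.
  by rewrite dotmulZl dotmulZr mulrA -expr2 exprVn sqr_sqrtr ?dotmul_ge0 // mulVf // gt_eqF.
by move=> i ik; rewrite dotmulZl wv // mulr0.
Qed.

End skew_normal_form.

Section skew_blocks.
Variables (R : realType) (N : nat) (A : 'M[R]_N).
Hypothesis skA : A^T = - A.
Implicit Types (x y w : 'rV[R]_N) (v : nat -> 'rV[R]_N).

Lemma skew_dot x y : dotmul (x *m A) y = - dotmul x (y *m A).
Proof. by rewrite dotmul_mulmx skA mulmxN dotmulNr. Qed.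

Lemma skew_dot0 x : dotmul x (x *m A) = 0.
Proof.
have := skew_dot x x; rewrite dotmulC => /eqP.
by rewrite -addr_eq0 -mulr2n mulrn_eq0 /= => /eqP.
Qed.

Definition orthogonal_upto v k x := forall i, (i < k)%N -> dotmul x (v i) = 0.

Definition invariant_planes v (lam : nat -> R) k :=
  forall a, (a < k)%N ->
    v a.*2 *m A = lam a *: v a.*2.+1 /\ v a.*2.+1 *m A = - lam a *: v a.*2.

Lemma orthogonal_upto_mul v lam k x : invariant_planes v lam k ->
  orthogonal_upto v k.*2 x -> orthogonal_upto v k.*2 (x *m A).
Proof.
move=> vA xv i ik; rewrite skew_dot -[i]odd_double_half.
have ak : (i./2 < k)%N by rewrite ltn_half_double.
have [eA oA] := vA _ ak; case: (odd i); rewrite ?add1n ?add0n ?eA ?oA dotmulZr xv ?mulr0 ?oppr0 //.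
  by rewrite ltn_double.
by rewrite -doubleS leq_double.
Qed.

(** With [m] the maximum, the quadratic form |wA|^2 - m |w|^2 is nonpositive on the
complement and vanishes at [x], hence its polar form at [x] vanishes too. *)
Lemma maximal_critical v k x w : dotmul x x = 1 ->
  orthogonal_upto v k x -> orthogonal_upto v k w ->
  (forall w, orthogonal_upto v k w ->
    dotmul (w *m A) (w *m A) <= dotmul (x *m A) (x *m A) * dotmul w w) ->
  dotmul (x *m A) (w *m A) = dotmul (x *m A) (x *m A) * dotmul x w.
Proof.
move=> xx xv wv xmax; set m := dotmul (x *m A) (x *m A) in xmax *.
set c := dotmul (x *m A) (w *m A); set d := dotmul x w.
set p := dotmul (w *m A) (w *m A); set q := dotmul w w.
have ineq t : 2 * t * (c - m * d) <= t ^+ 2 * (m * q - p).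
  have := xmax (x + t *: w); rewrite mulmxDl -scalemxAl.
  rewrite !(dotmulDl, dotmulDr, dotmulZl, dotmulZr) xx -/m -/p -/q -/d.
  rewrite (dotmulC (w *m A) (x *m A)) (dotmulC w x) -/c -/d => H.
  have /H {}H : orthogonal_upto v k (x + t *: w).
    by move=> i ik; rewrite dotmulDl dotmulZl xv // wv // mulr0 addr0.
  by move: H; rewrite ?expr2 => H; lra.
apply/eqP; rewrite -subr_eq0; set e := c - m * d in ineq *.
have s0 : 0 <= m * q - p by rewrite subr_ge0; exact: xmax.
set s := m * q - p in ineq s0.
have s1 : s + 1 != 0 by rewrite gt_eqF // ltr_wpDl.
set u := e / (s + 1); have eE : e = u * (s + 1) by rewrite divfK.
have := ineq u; rewrite eE => H.
have u0 : u ^+ 2 * (s + 2) <= 0 by rewrite ?expr2 in H *; lra.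
have : u ^+ 2 <= 0 by rewrite -(pmulr_lle0 (u ^+ 2) (_ : 0 < s + 2)) // ltr_wpDl.
by rewrite le_eqVlt ltNge sqr_ge0 orbF sqrf_eq0 => /eqP ->; rewrite mul0r.
Qed.

(** A unit vector [e] maximising |eA| satisfies [e *m A *m A^T = mu ^+ 2 *: e], so [e]
and [e *m A] span an invariant plane. If the maximum is zero, any orthonormal pair
of the complement will do. *)
Lemma exists_invariant_plane v k lam : (k.*2.+2 <= N)%N ->
  orthonormal_upto v k.*2 -> invariant_planes v lam k ->
  exists e f mu, [/\ [/\ dotmul e e = 1, dotmul f f = 1 & dotmul e f = 0],
    orthogonal_upto v k.*2 e, orthogonal_upto v k.*2 f &
    [/\ e *m A = mu *: f, f *m A = - mu *: e &
      forall w, orthogonal_upto v k.*2 w ->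
        dotmul (w *m A) (w *m A) <= mu ^+ 2 * dotmul w w]].
Proof.
move=> kN ov vA; have kN' : (k.*2 < N)%N by rewrite (leq_trans _ kN).
have [x [xx xv xmax]] := maximal_unit A v kN'.
set m := dotmul (x *m A) (x *m A) in xmax.
have m0 : 0 <= m := dotmul_ge0 _.
have sqm : Num.sqrt m ^+ 2 = m by rewrite sqr_sqrtr.
have [m_eq0|mn0] := eqVneq m 0.
  have wA w : orthogonal_upto v k.*2 w -> w *m A = 0.
    move=> wv; apply: dotmul_eq0; apply/eqP; rewrite eq_le dotmul_ge0 andbT.
    by have := xmax w wv; rewrite m_eq0 mul0r.
  pose v' i := if i == k.*2 then x else v i.
  have [f [ff fv']] := exists_orthogonal_unit v' kN.
  have fv : orthogonal_upto v k.*2 f.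
    by move=> i ik; have := fv' i (leqW ik); rewrite /v' ltn_eqF.
  have fx : dotmul f x = 0 by have := fv' k.*2 (ltnSn _); rewrite /v' eqxx.
  exists x, f, 0; split=> //; first by split=> //; rewrite dotmulC.
  split; rewrite ?oppr0 ?scale0r ?wA //.
  by move=> w wv; rewrite wA // dotmul0 expr0n /= mul0r.
have sm0 : Num.sqrt m != 0 by rewrite sqrtr_eq0 -ltNge lt_def mn0.
set mu := Num.sqrt m in sqm sm0.
have xAv := orthogonal_upto_mul vA xv.
have smu : mu^-1 * mu^-1 * m = 1 by rewrite -sqm; field.
exists x, (mu^-1 *: (x *m A)), mu; split=> //.
- by split; rewrite // ?dotmulZl dotmulZr ?mulrA -/m // skew_dot0 mulr0.
- by move=> i ik; rewrite dotmulZl xAv // mulr0.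
split.
- by rewrite scalerA mulfV // scale1r.
- (* Criticality of [x] makes the difference of the two sides self-orthogonal. *)
  set g := mu^-1 *: (x *m A) *m A.
  have gv : orthogonal_upto v k.*2 g.
    by apply: orthogonal_upto_mul vA _ => i ik; rewrite dotmulZl xAv // mulr0.
  apply/eqP; rewrite -subr_eq0 scaleNr opprK; apply/eqP; apply: dotmul_eq0.
  set h := g + mu *: x.
  have hv : orthogonal_upto v k.*2 h.
    by move=> i ik; rewrite dotmulDl dotmulZl gv // xv // mulr0 addr0.
  rewrite {1}/h dotmulDl dotmulZl /g -scalemxAl dotmulZl skew_dot.
  rewrite (maximal_critical xx xv hv xmax) -/m -sqm.
  by field.
- by move=> w wv; rewrite sqm; exact: xmax.
Qed.

(** Planes are split off in the order of decreasing rotation speed, because the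
maximum over a smaller complement cannot exceed the previous one. *)
Lemma exists_invariant_planes k : (k.*2 <= N)%N ->
  exists v lam, [/\ orthonormal_upto v k.*2, invariant_planes v lam k,
    forall a, (a.+1 < k)%N -> lam a.+1 ^+ 2 <= lam a ^+ 2 &
    forall a, (a < k)%N -> forall w, orthogonal_upto v k.*2 w ->
      dotmul (w *m A) (w *m A) <= lam a ^+ 2 * dotmul w w].
Proof.
elim: k => [|k IH] kN; first by exists (fun=> 0), (fun=> 0); split.
have [|v [lam [ov vA lamS bnd]]] := IH.
  by apply: leq_trans kN; rewrite doubleS; do 2 apply: leqW.
rewrite doubleS in kN *.
have [e [f [mu [[ee ff ef] ev fv [eA fA mubnd]]]]] := exists_invariant_plane kN ov vA.
pose v' i := if (i < k.*2)%N then v i else if i == k.*2 then e else f.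
pose lam' a := if (a < k)%N then lam a else mu.
have v'E i : (i < k.*2)%N -> v' i = v i by rewrite /v' => ->.
have v'e : v' k.*2 = e by rewrite /v' ltnn eqxx.
have v'f : v' k.*2.+1 = f by rewrite /v' ltnNge leqnSn /= gtn_eqF.
have sub w : orthogonal_upto v' k.*2.+2 w -> orthogonal_upto v k.*2 w.
  by move=> wv i ik; rewrite -v'E // wv // (leq_trans ik) // leqW.
have cases i : (i < k.*2.+2)%N -> [\/ (i < k.*2)%N, i = k.*2 | i = k.*2.+1].
  rewrite ltnS leq_eqVlt ltnS leq_eqVlt.
  by case/predU1P => [->|/predU1P[->|]]; [constructor 3|constructor 2|constructor 1].
exists v', lam'; split.
- move=> i j /cases ci /cases cj.
  case: ci => [ik|->|->]; case: cj => [jk|->|->]; rewrite ?v'e ?v'f ?v'E //.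
  + exact: ov.
  + by rewrite dotmulC ev // ltn_eqF.
  + by rewrite dotmulC fv // ltn_eqF // leqW.
  + by rewrite ev // gtn_eqF.
  + by rewrite ee eqxx.
  + by rewrite ef ltn_eqF.
  + by rewrite fv // gtn_eqF // leqW.
  + by rewrite dotmulC ef gtn_eqF.
  + by rewrite ff eqxx.
- move=> a; rewrite ltnS leq_eqVlt => /predU1P[->|ak].
    by rewrite v'e v'f /lam' ltnn.
  have a2 : (a.*2.+1 < k.*2)%N by rewrite -doubleS leq_double.
  by rewrite !v'E ?(ltnW a2) // /lam' ak; exact: vA.
- move=> a; rewrite ltnS leq_eqVlt => /predU1P[ak|ak].
    rewrite /lam' ak ltnn -ak ltnSn.
    have -> : mu ^+ 2 = dotmul (e *m A) (e *m A).
      by rewrite eA dotmulZl dotmulZr ff mulr1.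
    have := bnd a _ e ev; rewrite ee mulr1; apply.
    by rewrite -ak.
  by rewrite /lam' ak (ltnW ak) lamS.
- move=> a; rewrite ltnS leq_eqVlt => /predU1P[->|ak] w wv.
    by rewrite /lam' ltnn; apply: mubnd; exact: sub.
  by rewrite /lam' ak; apply: bnd => //; exact: sub.
Qed.

(** An orthonormal frame in which [A] consists of planar rotations, plus one
vector of the kernel when [N] is odd. *)
Theorem skew_normal_form : exists (Q : 'M[R]_N) (lam : nat -> R),
  [/\ Q *m Q^T = 1%:M,
    forall i j, (Q *m A *m Q^T) i j =
      (lam i./2 * ((i < j)%:R - (j < i)%:R)) *+ (i./2 == j./2),
    forall i, row i Q *m A *m A^T = lam i./2 ^+ 2 *: row i Q &
    forall a, lam a.+1 ^+ 2 <= lam a ^+ 2].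
Proof.
set k := N./2.
have kN : (k.*2 <= N)%N by rewrite -[leqRHS]odd_double_half leq_addl.
have [v [lam [ov vA lamS _]]] := exists_invariant_planes kN.
pose lam' a := if (a < k)%N then lam a else 0.
have NE : N = k.*2 \/ N = k.*2.+1.
  by have := odd_double_half N; rewrite -/k; case: (odd N); [right|left].
have [v' ov' v'E] : exists2 v' : nat -> 'rV[R]_N, orthonormal_upto v' N &
    forall i, (i < k.*2)%N -> v' i = v i.
  case: NE => NE.
    by exists v => // i j iN jN; apply: ov; rewrite -NE.
  have [|x [xx xv]] := @exists_orthogonal_unit _ N v k.*2; first by rewrite [ltnRHS]NE.
  exists (fun i => if (i < k.*2)%N then v i else x) => [i j iN jN|i ->] //.
  have {}iN : (i <= k.*2)%N by rewrite -ltnS -NE.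
  have {}jN : (j <= k.*2)%N by rewrite -ltnS -NE.
  case: ltnP => ik'; case: ltnP => jk'.
  - exact: ov.
  - by rewrite dotmulC xv // ltn_eqF // (leq_trans ik').
  - by rewrite xv // gtn_eqF // (leq_trans jk').
  - have -> : i = j by apply/eqP; rewrite eqn_leq (leq_trans iN) ?(leq_trans jN).
    by rewrite xx eqxx.
pose Q : 'M[R]_N := \matrix_(i < N) v' i.
have QE (B : 'M[R]_N) i j : (Q *m B *m Q^T) i j = dotmul (v' i *m B) (v' j).
  rewrite dotmulE mxE; apply: eq_bigr => l _; rewrite [Q^T l j]mxE [Q j l]mxE.
  by congr (_ * _); rewrite !mxE; apply: eq_bigr => l' _; rewrite mxE.
have QQ : Q *m Q^T = 1%:M.
  apply/matrixP => i j; rewrite -[Q in Q *m _]mulmx1 QE mulmx1 ov' ?ltn_ord //.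
  by rewrite mxE.
have vA' a : (a < k)%N -> v' a.*2 *m A = lam' a *: v' a.*2.+1 /\
    v' a.*2.+1 *m A = - lam' a *: v' a.*2.
  move=> ak; have a2 : (a.*2.+1 < k.*2)%N by rewrite -doubleS leq_double.
  by rewrite !v'E ?(ltnW a2) // /lam' ak; exact: vA.
have v0 i : (k <= i./2)%N -> (i < N)%N -> v' i *m A = 0.
  move=> ki iN; have ik : (k.*2 <= i)%N.
    by rewrite (leq_trans _ (_ : i./2.*2 <= i)%N) ?leq_double // -[leqRHS]odd_double_half leq_addl.
  have orth j : (j < N)%N -> dotmul (v' i *m A) (v' j) = 0.
    move=> jN; have [ji|jk] : j = i \/ (j < k.*2)%N.
    - case: NE => NE; first by right; rewrite -NE.
      case: (ltnP j k.*2) => jk; first by right.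
      left; apply/eqP; rewrite eqn_leq.
      have jk' : (j <= k.*2)%N by rewrite -ltnS -NE.
      have ik' : (i <= k.*2)%N by rewrite -ltnS -NE.
      by rewrite (leq_trans jk') // (leq_trans ik').
    - by rewrite ji dotmulC skew_dot0.
    have ak : (j./2 < k)%N by rewrite ltn_half_double.
    have ne l : (l < k.*2)%N -> dotmul (v' i) (v' l) = 0.
      move=> lk; rewrite ov' ?gtn_eqF ?(leq_trans lk) //.
    have a2 : (j./2.*2.+1 < k.*2)%N by rewrite -doubleS leq_double.
    have [eA oA] := vA' _ ak; rewrite skew_dot -[j]odd_double_half.
    by case: (odd j); rewrite ?add1n ?add0n ?eA ?oA dotmulZr ne ?mulr0 ?oppr0 // ltnW.
  have /(congr1 (mulmx^~ Q)) : v' i *m A *m Q^T = 0.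
    apply/rowP => j; rewrite [RHS]mxE -[RHS](orth j) ?ltn_ord // dotmulE mxE.
    by apply: eq_bigr => l _; rewrite !mxE.
  by rewrite -mulmxA (mulmx1C QQ) mulmx1 mul0mx.
have halfP i : i = i./2.*2 \/ i = i./2.*2.+1.
  by have := odd_double_half i; case: (odd i); [right|left].
have inN a : (a < k)%N -> (a.*2.+1 < N)%N.
  by move=> ak; rewrite (leq_trans _ kN) // -doubleS leq_double.
exists Q, lam'; split=> //.
- move=> i j; rewrite QE; case: (ltnP i./2 k) => ak; last first.
    by rewrite v0 // /lam' ltnNge ak /= mul0r mul0rn dotmulC dotmul0.
  have [eA oA] := vA' _ ak; have := ltn_ord j; have := inN _ ak.
  case: eqP => [ij|ij]; last first.
    move=> lt1 jN; case: (halfP i) => iE; rewrite iE ?eA ?oA dotmulZl ov' ?(ltnW lt1) // mulr0n.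
      by case: eqP => [e|_]; rewrite ?mulr0 //; case: ij; rewrite -e /= uphalf_double.
    by case: eqP => [e|_]; rewrite ?mulr0 //; case: ij; rewrite -e doubleK.
  case: (halfP i) => iE; case: (halfP j) => jE; move=> lt1 jN; rewrite iE jE -ij mulr1n.
  + by rewrite eA dotmulZl ov' ?(ltnW lt1) // gtn_eqF // ltnn subrr doubleK.
  + by rewrite eA dotmulZl ov' // eqxx ltnSn ltnNge leqnSn /= doubleK subr0.
  + rewrite oA dotmulZl ov' ?(ltnW lt1) // eqxx ltnSn ltnNge leqnSn /=.
    by rewrite uphalf_double sub0r mulrN1 mulr1.
  + by rewrite oA dotmulZl ov' ?(ltnW lt1) // ltn_eqF // ltnn subrr !mulr0.
- move=> i; rewrite rowK skA mulmxN; case: (ltnP i./2 k) => ak; last first.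
    by rewrite v0 // mul0mx oppr0 /lam' ltnNge ak expr0n scale0r.
  have [eA oA] := vA' _ ak.
  by case: (halfP i) => {1 3}->; rewrite ?eA ?oA -scalemxAl ?eA ?oA scalerA -scaleNr;
    congr (_ *: _); rewrite expr2 ?mulrN ?mulNr ?opprK.
- move=> a; rewrite /lam'; case: ltnP => ak; last by rewrite expr0n /= sqr_ge0.
  by rewrite (ltnW ak) lamS.
Qed.

End skew_blocks.

(** * The magnetic symplectic form as a pullback *)

Section vector_fields.
Variables (R : realType) (m : nat).

Definition pole_free_row k (g : 'rV[R]_m -> 'rV[R]_k) :=
  forall i, pole_free (fun z => g z 0 i).

Fact row_derive_key : unit. Proof. by []. Qed.

(** Locked because unification would otherwise unfold limits when it compares
directional derivatives of unrelated maps. *)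
Definition row_derive := locked_with row_derive_key
  (fun k (g : 'rV[R]_m -> 'rV[R]_k) (z v : 'rV[R]_m) =>
    (\row_i 'D_v (fun z => g z 0 i) z) : 'rV[R]_k).

Lemma row_deriveE k (g : 'rV[R]_m -> 'rV[R]_k) z v i :
  row_derive g z v 0 i = 'D_v (fun z => g z 0 i) z.
Proof. by rewrite /row_derive unlock mxE. Qed.

Lemma pole_free_row_derive k (g : 'rV[R]_m -> 'rV[R]_k) v :
  pole_free_row g -> pole_free_row (row_derive g ^~ v).
Proof. by move=> rg i; under eq_fun do rewrite row_deriveE; exact: pole_free_derive. Qed.

Lemma derive_dotmul k (g h : 'rV[R]_m -> 'rV[R]_k) z v :
  pole_free_row g -> pole_free_row h ->
  'D_v (fun z => dotmul (g z) (h z)) z =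
  dotmul (row_derive g z v) (h z) + dotmul (g z) (row_derive h z v).
Proof.
move=> rg rh.
have -> : (fun z => dotmul (g z) (h z)) = \sum_i (fun z => g z 0 i * h z 0 i).
  by apply/funext => w; rewrite fct_sumE dotmulE.
rewrite (is_deriveE (is_derive_sum (fun i => is_derive_mul
  (pole_free_is_derive z v (rg i)) (pole_free_is_derive z v (rh i))))).
by rewrite !dotmulE -big_split /=; apply: eq_bigr => i _; rewrite !row_deriveE.
Qed.

Lemma row_deriveD k (g h : 'rV[R]_m -> 'rV[R]_k) z v :
  pole_free_row g -> pole_free_row h ->
  row_derive (fun z => g z + h z) z v = row_derive g z v + row_derive h z v.
Proof.
move=> rg rh; apply/rowP => i; rewrite mxE !row_deriveE; under eq_fun do rewrite mxE.
exact: (is_deriveE (is_deriveD (pole_free_is_derive z v (rg i))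
  (pole_free_is_derive z v (rh i)))).
Qed.

Lemma mulmx_dotmul k l (x : 'rV[R]_k) (B : 'M[R]_(k, l)) j :
  (x *m B) 0 j = dotmul x (col j B)^T.
Proof. by rewrite dotmulE mxE; apply: eq_bigr => i _; rewrite !mxE. Qed.

Lemma row_derive_cst k (c : 'rV[R]_k) z v : row_derive (fun=> c) z v = 0.
Proof. by apply/rowP => i; rewrite row_deriveE mxE; exact: derive_cst. Qed.

Lemma row_derive_mulmx k l (g : 'rV[R]_m -> 'rV[R]_k) (B : 'M[R]_(k, l)) z v :
  pole_free_row g -> row_derive (fun z => g z *m B) z v = row_derive g z v *m B.
Proof.
move=> rg; apply/rowP => j; rewrite row_deriveE.
have col_cst : pole_free_row (fun=> (col j B)^T : 'rV[R]_k).
  by move=> i; exact: pole_free_cst.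
rewrite (_ : (fun z => _) = fun z => dotmul (g z) (col j B)^T); last first.
  by apply/funext => w; rewrite mulmx_dotmul.
by rewrite derive_dotmul // row_derive_cst dotmul0 addr0 mulmx_dotmul.
Qed.

Lemma row_derive_sym k (g : 'rV[R]_m -> 'rV[R]_k) z v w : pole_free_row g ->
  row_derive (row_derive g ^~ w) z v = row_derive (row_derive g ^~ v) z w.
Proof.
move=> rg; apply/rowP => i.
have E a : (fun z => row_derive g z a 0 i) = 'D_a (fun z => g z 0 i).
  by apply/funext => z'; rewrite row_deriveE.
by rewrite !row_deriveE !E (pole_free_schwarz (rg i)).
Qed.

Lemma derive_gradient (f : 'rV[R]_m -> R) z v : differentiable f z ->
  'D_v f z = dotmul (gradient f z) v.
Proof.
move=> df; rewrite deriveE // [in LHS](row_sum_delta v) linear_sum dotmulE.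
apply: eq_bigr => i _; rewrite linearZ mxE deriveE //.
by rewrite /GRing.scale /= mulrC.
Qed.

End vector_fields.

Section vector_field_closure.
Variable R : realType.

Lemma pole_free_lsubmx n : pole_free_row (lsubmx : 'rV[R]_(n + n) -> 'rV[R]_n).
Proof. by move=> i; under eq_fun do rewrite mxE; exact: pole_free_coord. Qed.

Lemma pole_free_rsubmx n : pole_free_row (rsubmx : 'rV[R]_(n + n) -> 'rV[R]_n).
Proof. by move=> i; under eq_fun do rewrite mxE; exact: pole_free_coord. Qed.

Lemma pole_free_row_mx m k l (f : 'rV[R]_m -> 'rV[R]_k) (g : 'rV[R]_m -> 'rV[R]_l) :
  pole_free_row f -> pole_free_row g -> pole_free_row (fun z => row_mx (f z) (g z)).
Proof.
move=> rf rg i; case: (split_ordP i) => j ->.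
  by under eq_fun do rewrite row_mxEl; exact: rf.
by under eq_fun do rewrite row_mxEr; exact: rg.
Qed.

Lemma pole_free_scalar m (f : 'rV[R]_m -> R) :
  pole_free f -> pole_free_row (fun z => (f z)%:M : 'rV[R]_1).
Proof. by move=> rf i; under eq_fun do rewrite mxE ord1 eqxx mulr1n. Qed.

Lemma pole_freeZ m k (f : 'rV[R]_m -> R) (g : 'rV[R]_m -> 'rV[R]_k) :
  pole_free f -> pole_free_row g -> pole_free_row (fun z => f z *: g z).
Proof. by move=> rf rg i; under eq_fun do rewrite mxE; exact: pole_freeM. Qed.

Lemma pole_free_rowD m k (f g : 'rV[R]_m -> 'rV[R]_k) :
  pole_free_row f -> pole_free_row g -> pole_free_row (fun z => f z + g z).
Proof. by move=> rf rg i; under eq_fun do rewrite mxE; exact: pole_freeD. Qed.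

Lemma gram_pairing k l (J : 'M[R]_(k, l)) (p a : 'rV[R]_k) :
  J *m J^T \in unitmx ->
  dotmul (p *m invmx (J *m J^T) *m J) (a *m J) = dotmul p a.
Proof.
move=> uG; rewrite dotmulC dotmul_mulmx dotmulC.
by rewrite -[X in dotmul X _]mulmxA mulmxKV.
Qed.

End vector_field_closure.

Section twisted_pullback.
Variables (R : realType) (n k : nat) (A Q : 'M[R]_k).
Variables x y : 'rV[R]_(n + n) -> 'rV[R]_k.
Hypotheses (rx : pole_free_row x) (ry : pole_free_row y).
Hypothesis pairing : forall z v,
  dotmul (y z) (row_derive x z v) = dotmul (rsubmx z) (lsubmx v).

Lemma row_derive_rsubmx (z v : 'rV[R]_(n + n)) : row_derive rsubmx z v = rsubmx v.
Proof.
apply/rowP => i; rewrite row_deriveE.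
rewrite (_ : (fun z => _) = fun z' : 'rV[R]_(n + n) => z' 0 (rshift n i)).
  by rewrite derive_coord mxE.
by apply/funext => z'; rewrite mxE.
Qed.

(** Differentiating the pairing gives the tautological one-form; its exterior
derivative kills the second derivatives of [x]. *)
Lemma canonical_pullback z v w :
  dotmul (row_derive y z v) (row_derive x z w)
  - dotmul (row_derive y z w) (row_derive x z v)
  = dotmul (rsubmx v) (lsubmx w) - dotmul (rsubmx w) (lsubmx v).
Proof.
have E v' w' : dotmul (row_derive y z v') (row_derive x z w')
    + dotmul (y z) (row_derive (row_derive x ^~ w') z v')
    = dotmul (rsubmx v') (lsubmx w').
  rewrite -derive_dotmul //; last exact: pole_free_row_derive.
  have -> : (fun z => dotmul (y z) (row_derive x z w')) =
      (fun z => dotmul (rsubmx z) ((fun=> lsubmx w') z)).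
    by apply/funext => z'; rewrite pairing.
  have rc : pole_free_row ((fun=> lsubmx w') : 'rV[R]_(n + n) -> 'rV[R]_n).
    by move=> i; exact: pole_free_cst.
  rewrite derive_dotmul //; last exact: pole_free_rsubmx.
  by rewrite row_derive_cst dotmul0 addr0 row_derive_rsubmx.
have cancel (a b t p q : R) : a + t = p -> b + t = q -> a - b = p - q.
  by move=> <- <-; rewrite opprD addrACA subrr addr0.
apply: cancel (E v w) _; apply: etrans (E w v).
by apply: congr1; apply: congr1; exact: row_derive_sym.
Qed.

Lemma dotmul_rot (a b : 'rV[R]_k) : Q *m Q^T = 1%:M ->
  dotmul (a *m Q^T) (b *m Q^T) = dotmul a b.
Proof.
by move=> QQ; rewrite dotmul_mulmx trmxK -mulmxA (mulmx1C QQ) mulmx1.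
Qed.

Lemma twisted_pullback z v w : Q *m Q^T = 1%:M ->
  let X z := x z *m Q^T in let Y z := (y z + x z *m A) *m Q^T in
  dotmul (row_derive Y z v) (row_derive X z w)
  - dotmul (row_derive Y z w) (row_derive X z v)
  = dotmul (row_derive x z v *m A) (row_derive x z w)
    - dotmul (row_derive x z w *m A) (row_derive x z v)
    + (dotmul (rsubmx v) (lsubmx w) - dotmul (rsubmx w) (lsubmx v)).
Proof.
move=> QQ X Y; rewrite -(canonical_pullback z v w) /X /Y.
have rxA : pole_free_row (fun z => x z *m A) by move=> i; exact: pole_free_mulmx.
have ryA : pole_free_row (fun z => y z + x z *m A) by exact: pole_free_rowD.
rewrite !row_derive_mulmx // !row_deriveD // !row_derive_mulmx //.
have regroup (a b c d : R) : a + c - (b + d) = c - d + (a - b).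
  by rewrite opprD addrACA addrC.
rewrite !(dotmul_rot _ _ QQ).
rewrite !dotmulDl.
exact: regroup.
Qed.

End twisted_pullback.

Section embedding.
Variables (R : realType) (n : nat) (A : 'M[R]_(n + 1)) (Q : 'M[R]_(n + 1)).
Hypothesis QQ : Q *m Q^T = 1%:M.
Implicit Types (z v w : 'rV[R]_(n + n)).

Definition position (c : cotangent_sphere R n) : 'rV[R]_(n + 1) :=
  (sval c).1 *m Q^T.

Definition momentum (c : cotangent_sphere R n) : 'rV[R]_(n + 1) :=
  ((sval c).2 + (sval c).1 *m A) *m Q^T.

Variable s : bool.

Let x z := (sval (cotangent_chart s z)).1.
Let y z := (sval (cotangent_chart s z)).2.
Let X z := position (cotangent_chart s z).
Let Y z := momentum (cotangent_chart s z).

Lemma pole_free_den m (f : 'rV[R]_m -> 'rV[R]_n) : pole_free_row f ->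
  pole_free (fun u => 1 + dotmul (f u) (f u)).
Proof.
by move=> rf; apply: pole_freeD; [exact: pole_free_cst|exact: pole_free_dotmul].
Qed.

Lemma pole_free_stereo m (f : 'rV[R]_m -> 'rV[R]_n) : pole_free_row f ->
  pole_free_row (fun u => stereo s (f u)).
Proof.
move=> rf; apply: pole_freeZ.
  by apply: pole_freeV => [|z]; [exact: pole_free_den|exact: stereo_den_neq0].
apply: pole_free_row_mx; first by apply: pole_freeZ => //; exact: pole_free_cst.
apply: pole_free_scalar; apply: pole_freeM; first exact: pole_free_cst.
by apply: pole_freeD; [exact: pole_free_dotmul|exact: pole_free_cst].
Qed.

Lemma covectorE z : y z = ((1 + dotmul (lsubmx z) (lsubmx z)) / 4) *:
  (2 *: row_mx (rsubmx z) ((-1) ^+ s * dotmul (lsubmx z) (rsubmx z))%:M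
   + (- (2 * dotmul (lsubmx z) (rsubmx z))) *: stereo s (lsubmx z)).
Proof.
rewrite /y /= metricE invmx_scalar mul_mx_scalar -scalemxAl stereo_jacobian.
have d0 := stereo_den_neq0 (lsubmx z).
rewrite scalerA scaleNr; congr (_ *: _); by field.
Qed.

Lemma pole_free_x : pole_free_row x.
Proof. by apply: pole_free_stereo; exact: pole_free_lsubmx. Qed.

Lemma pole_free_y : pole_free_row y.
Proof.
have rl := @pole_free_lsubmx R n; have rr := @pole_free_rsubmx R n.
have rd : pole_free (fun z => dotmul (lsubmx z) (rsubmx z)).
  exact: pole_free_dotmul.
rewrite (funext covectorE); apply: pole_freeZ.
  by apply: pole_freeM; [exact: pole_free_den|exact: pole_free_cst].
apply: pole_free_rowD; apply: pole_freeZ.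
- exact: pole_free_cst.
- apply: pole_free_row_mx => //; apply: pole_free_scalar.
  by apply: pole_freeM => //; exact: pole_free_cst.
- by apply: pole_freeN; apply: pole_freeM => //; exact: pole_free_cst.
- exact: pole_free_stereo.
Qed.

Lemma pole_free_position : pole_free_row X.
Proof. by move=> i; apply: pole_free_mulmx; exact: pole_free_x. Qed.

Lemma pole_free_momentum : pole_free_row Y.
Proof.
move=> i; apply: pole_free_mulmx; apply: pole_free_rowD; first exact: pole_free_y.
by move=> j; apply: pole_free_mulmx; exact: pole_free_x.
Qed.

Lemma derive_lsubmx k (f : 'rV[R]_n -> 'rV[R]_k) z v i :
  'D_v (fun z => f (lsubmx z) 0 i : R) z =
  'D_(lsubmx v) (fun u => f u 0 i : R) (lsubmx z).
Proof.
rewrite /derive; set F := (F in lim (F @ _) = _); set G := (G in _ = lim (G @ _)).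
suff -> : F = G by [].
apply/funext => h; rewrite /F /G /=; congr (_ *: (f _ _ _ - _)).
by apply/rowP => j; rewrite !mxE.
Qed.

Lemma row_derive_x z v : row_derive x z v = lsubmx v *m 'J (stereo s) (lsubmx z).
Proof.
have dS := differentiable_stereo s (lsubmx z).
rewrite -deriveEjacobian //; apply/rowP => a; rewrite row_deriveE derive_lsubmx.
have [_ ->] // := @is_derive_coord _ _ _ (stereo s) (lsubmx z) (lsubmx v) a
  (diff_derivable dS).
Qed.

Lemma row_derive_position z v : row_derive X z v =
  lsubmx v *m 'J (stereo s) (lsubmx z) *m Q^T.
Proof. by rewrite row_derive_mulmx ?row_derive_x //; exact: pole_free_x. Qed.

Lemma covector_pairing z v :
  dotmul (y z) (row_derive x z v) = dotmul (rsubmx z) (lsubmx v).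
Proof.
rewrite row_derive_x; exact: gram_pairing (metric_unit s (lsubmx z)).
Qed.

(** In coordinates, the twisted form on the cotangent bundle is the pullback of
the canonical form of the ambient space by the position and the momentum
shifted by the primitive [x A] of the magnetic form. *)
Lemma Omega_pert_pullback z v w : Omega_pert A s z v w =
  dotmul (row_derive Y z v) (row_derive X z w)
  - dotmul (row_derive Y z w) (row_derive X z v).
Proof.
apply: etrans (esym (twisted_pullback A pole_free_x pole_free_y
  covector_pairing z v w QQ)).
rewrite /Omega_pert; congr (_ + _); last by rewrite sumrB -!dotmulE.
rewrite !row_derive_x; set J := 'J (stereo s) (lsubmx z).
have bil (a b : 'rV[R]_n) : dotmul (a *m J *m A) (b *m J) =
    \sum_i \sum_j magnetic A s (lsubmx z) i j * (a 0 i * b 0 j).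
  rewrite dotmulC dotmul_mulmx dotmulC.
  rewrite -!mulmxA [J *m _]mulmxA -/(magnetic A s (lsubmx z)).
  move: (magnetic _ _ _) => M; rewrite dotmulE.
  under eq_bigr do rewrite mxE mulr_suml.
  rewrite exchange_big; apply: eq_bigr => i _; apply: eq_bigr => j _ /=.
  by rewrite mulrCA mulrA.
rewrite !bil -sumrB; apply: eq_bigr => i _; rewrite -sumrB.
by apply: eq_bigr => j _; rewrite mulrBr.
Qed.

End embedding.

(** * Poisson brackets in ambient terms *)

Section poisson_bracket.
Variables (R : realType) (n : nat) (A : 'M[R]_(n + 1)) (Q : 'M[R]_(n + 1)).
Hypotheses (skA : A^T = - A) (QQ : Q *m Q^T = 1%:M).
Variable s : bool.
Implicit Types (z v w : 'rV[R]_(n + n)).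

Let X z := position Q (cotangent_chart s z).
Let Y z := momentum A Q (cotangent_chart s z).

Lemma position_unit (c : cotangent_sphere R n) :
  dotmul (position Q c) (position Q c) = 1.
Proof.
by rewrite dotmul_rot //; case: c => -[x y] /= /andP[/eqP].
Qed.

Lemma position_momentum (c : cotangent_sphere R n) :
  dotmul (position Q c) (momentum A Q c) = 0.
Proof.
rewrite dotmul_rot //; case: c => -[x y] /= /andP[_ /eqP xy].
by rewrite dotmulDr xy skew_dot0 // addr0.
Qed.

(** The rows of the Jacobian together with the position itself form a basis of
the ambient space, with block diagonal Gram matrix. *)
Lemma tangent_space (u : 'rV[R]_n) (a : 'rV[R]_(n + 1)) :
  dotmul a (stereo s u) = 0 -> exists b, a = b *m 'J (stereo s) u.
Proof.
move=> au; set J := 'J (stereo s) u; set x := stereo s u in au.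
have xJ : x *m J^T = 0.
  by apply/rowP => i; rewrite mulmx_dotmul tr_col trmxK rowE stereo_tangent mxE.
have Jx : J *m x^T = 0 by rewrite -[J]trmxK -trmx_mul xJ trmx0.
have xx : x *m x^T = 1%:M.
  by rewrite [LHS]mx11_scalar -/(dotmul x x) stereo_sphere.
pose B := col_mx J x; pose E := block_mx (invmx (metric s u)) 0 0 (1%:M : 'M[R]_1).
have BE : B *m (B^T *m E) = 1%:M.
  rewrite mulmxA /B tr_col_mx mul_col_row Jx xJ xx -/J -/(metric s u) mulmx_block.
  by rewrite !mul0mx !mulmx0 !addr0 !add0r mulmxV ?metric_unit // mulmx1 -scalar_mx_block.
exists (a *m J^T *m invmx (metric s u)).
rewrite -[LHS]mulmx1 -(mulmx1C BE) !mulmxA /B tr_col_mx mul_mx_row.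
have -> : a *m x^T = 0 by rewrite [LHS]mx11_scalar -/(dotmul a x) au raddf0.
by rewrite mul_row_block mul_row_col !mulmx0 !mul0mx !addr0 mul0mx addr0.
Qed.

Lemma row_derive_position_vertical z q : row_derive X z (row_mx 0 q) = 0.
Proof. by rewrite row_derive_position row_mxKl !mul0mx. Qed.

Lemma position_tangent z v : dotmul (X z) (row_derive X z v) = 0.
Proof. by rewrite row_derive_position dotmul_rot // stereo_tangent. Qed.

Lemma tangent_lift z (b : 'rV[R]_(n + 1)) : dotmul (X z) b = 0 ->
  exists v, b = row_derive X z v.
Proof.
move=> Xb; have bE : b = b *m Q *m Q^T by rewrite -mulmxA QQ mulmx1.
have [|a bQ] := @tangent_space (lsubmx z) (b *m Q).
  by rewrite dotmulC -(dotmul_rot _ _ QQ) -bE.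
by exists (row_mx a 0); rewrite row_derive_position row_mxKl -bQ.
Qed.

(** A fibre of the cotangent bundle is Lagrangian and dual to the tangent space:
momenta pair with all tangent vectors. *)
Lemma vertical_separates z (b : 'rV[R]_(n + 1)) : dotmul (X z) b = 0 ->
  (forall q, dotmul b (row_derive Y z (row_mx 0 q)) = 0) -> b = 0.
Proof.
move=> Xb bY; have [v bE] := tangent_lift Xb.
suff l0 : lsubmx v = 0 by rewrite bE row_derive_position l0 !mul0mx.
apply: dotmul_eq0; rewrite -(bY (lsubmx v)) dotmulC bE.
have := Omega_pert_pullback A QQ s z (row_mx 0 (lsubmx v)) v.
rewrite -/X -/Y row_derive_position_vertical dotmul0 subr0 => <-.
rewrite /Omega_pert row_mxKl row_mxKr big1 ?add0r => [|i _].
  by rewrite dotmulE; apply: eq_bigr => i _; rewrite !mxE mulr0 subr0.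
by rewrite big1 // => j _; rewrite !mxE mul0r mulr0 subrr mulr0.
Qed.

(** The formulas for directional derivatives are the chain rule for functions of
position and momentum with the given partial gradients. Orthogonality of [fy] to
the position says that [f] does not depend on the normal part of the momentum, so
that its ambient hamiltonian vector field is tangent to the sphere. *)
Lemma poisson_embedding (f h : 'rV[R]_(n + n) -> R) z
    (fx fy hx hy : 'rV[R]_(n + 1)) :
  differentiable f z -> differentiable h z ->
  (forall v, 'D_v f z = dotmul fx (row_derive X z v) + dotmul fy (row_derive Y z v)) ->
  (forall v, 'D_v h z = dotmul hx (row_derive X z v) + dotmul hy (row_derive Y z v)) ->
  dotmul (X z) fy = 0 -> dotmul (X z) hy = 0 ->
  poisson A s f h z = dotmul hx fy - dotmul fx hy.
Proof.
move=> df dh Df Dh Xfy Xhy.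
have field g gx gy : differentiable g z ->
    (forall v, 'D_v g z = dotmul gx (row_derive X z v) + dotmul gy (row_derive Y z v)) ->
    dotmul (X z) gy = 0 ->
    row_derive X z (ham_field A s g z) = - gy /\
    (forall w, dotmul (row_derive Y z (ham_field A s g z)) (row_derive X z w) =
       dotmul gx (row_derive X z w)).
  move=> dg Dg Xgy; set V := ham_field A s g z.
  have VE w : dotmul (row_derive Y z V) (row_derive X z w)
      - dotmul (row_derive Y z w) (row_derive X z V)
      = dotmul gx (row_derive X z w) + dotmul gy (row_derive Y z w).
    rewrite -Dg -(Omega_pert_pullback A QQ) ham_fieldP.
    by rewrite derive_gradient.
  have XV : row_derive X z V = - gy.
    apply/eqP; rewrite -addr_eq0; apply/eqP.
    have Xg : dotmul (X z) (row_derive X z V + gy) = 0.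
      by rewrite dotmulDr Xgy addr0; exact: position_tangent.
    apply: vertical_separates Xg _ => q.
    have := VE (row_mx 0 q); rewrite row_derive_position_vertical !dotmul0.
    by rewrite sub0r add0r dotmulDl => <-; rewrite dotmulC subrr.
  split=> // w; have := VE w; rewrite XV dotmulNr opprK (dotmulC _ gy).
  exact: addIr.
rewrite /poisson (Omega_pert_pullback A QQ).
have [fX fY] := field _ _ _ df Df Xfy; have [hX hY] := field _ _ _ dh Dh Xhy.
by rewrite -/X -/Y fY hY fX hX !dotmulNr opprK addrC.
Qed.

End poisson_bracket.

(** * Brackets of quadratic and linear ambient integrals *)

Section ambient_brackets.
Variables (R : realType) (N : nat).
Implicit Types (X Y : 'rV[R]_N) (c : 'I_N -> 'I_N -> R) (d : 'I_N -> R) (B : 'M[R]_N).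

Definition rotation X Y i j := X 0 i * Y 0 j - X 0 j * Y 0 i.

(** The coefficients [c] describe a quadratic form in the angular momenta, that is,
a Killing tensor of the sphere, and [d] a quadratic potential. *)
Definition quad_integral c d X Y :=
  2^-1 * \sum_i \sum_j c i j * rotation X Y i j ^+ 2 + \sum_i d i * X 0 i ^+ 2.

Definition quad_grad_pos c d X Y : 'rV[R]_N :=
  \row_k (2 * \sum_j c k j * rotation X Y k j * Y 0 j + 2 * d k * X 0 k).

Definition quad_grad_mom c X Y : 'rV[R]_N :=
  \row_k (- 2 * \sum_j c k j * rotation X Y k j * X 0 j).

Definition lin_integral B X Y := dotmul (X *m B) Y.

Lemma rotationC X Y i j : rotation X Y j i = - rotation X Y i j.
Proof. by rewrite /rotation opprB. Qed.

Lemma double_half (r : R) : r + r = 0 -> r = 0.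
Proof. by move/eqP; rewrite -mulr2n mulrn_eq0 /= => /eqP. Qed.

Lemma sum2_antisym (a : 'I_N -> 'I_N -> R) :
  (forall i j, a i j + a j i = 0) -> \sum_i \sum_j a i j = 0.
Proof.
move=> ha; apply: double_half; rewrite {2}exchange_big -big_split big1 // => i _.
by rewrite -big_split big1 // => j _; exact: ha.
Qed.

Lemma sum3_antisym (a : 'I_N -> 'I_N -> 'I_N -> R) :
  (forall k j l, a k j l + a k l j + (a j k l + a j l k) + (a l k j + a l j k) = 0) ->
  \sum_k \sum_j \sum_l a k j l = 0.
Proof.
move=> ha; set W := LHS.
have W1 : \sum_k \sum_j \sum_l a k l j = W.
  by apply: eq_bigr => k _; rewrite exchange_big.
have W2 : \sum_k \sum_j \sum_l a j k l = W by rewrite exchange_big.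
have W3 : \sum_k \sum_j \sum_l a j l k = W.
  rewrite exchange_big -W1; apply: eq_bigr => j _.
  by rewrite exchange_big; apply: eq_bigr => l _.
have W4 : \sum_k \sum_j \sum_l a l k j = W.
  under eq_bigr do rewrite exchange_big /=.
  by rewrite exchange_big.
have W5 : \sum_k \sum_j \sum_l a l j k = W.
  under eq_bigr do rewrite exchange_big /=.
  rewrite exchange_big -W1; apply: eq_bigr => l _ /=.
  by rewrite exchange_big.
have : W + W + (W + W) + (W + W) = 0.
  transitivity (W + \sum_k \sum_j \sum_l a k l j
      + (\sum_k \sum_j \sum_l a j k l + \sum_k \sum_j \sum_l a j l k)
      + (\sum_k \sum_j \sum_l a l k j + \sum_k \sum_j \sum_l a l j k)).
    by rewrite W1 W2 W3 W4 W5.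
  rewrite /W -!big_split big1 // => k _ /=.
  rewrite -!big_split big1 // => j _ /=; rewrite -!big_split big1 // => l _ /=.
  exact: ha.
by lra.
Qed.

Lemma position_quad_grad_mom c X Y : (forall i j, c i j = c j i) ->
  dotmul X (quad_grad_mom c X Y) = 0.
Proof.
move=> cC; rewrite dotmulE.
transitivity (- 2 * \sum_i \sum_j c i j * rotation X Y i j * (X 0 i * X 0 j)).
  rewrite mulr_sumr; apply: eq_bigr => i _; rewrite mxE mulrCA; congr (_ * _).
  by rewrite mulr_sumr; apply: eq_bigr => j _; ring.
by rewrite sum2_antisym ?mulr0 // => i j; rewrite (cC j) (rotationC _ _ i); ring.
Qed.

(** The triple products of rotations are totally antisymmetric, so only the
antisymmetrisation of [c k j * c' k l] matters; the terms of lowest degree in the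
momenta give the condition on pairs. *)
Lemma quad_quad_bracket c d c' d' X Y :
  (forall i j, c i j = c j i) -> (forall i j, c' i j = c' j i) ->
  (forall k j l, c k j * c' k l - c k l * c' k j + (c j l * c' j k - c j k * c' j l)
     + (c l k * c' l j - c l j * c' l k) = 0) ->
  (forall k j, (d' k - d' j) * c k j = (d k - d j) * c' k j) ->
  dotmul (quad_grad_pos c' d' X Y) (quad_grad_mom c X Y)
  - dotmul (quad_grad_pos c d X Y) (quad_grad_mom c' X Y) = 0.
Proof.
move=> cC c'C triple pair; rewrite !dotmulE -sumrB; set M := rotation X Y.
have MC i j : M j i = - M i j by exact: rotationC.
transitivity (- 4 * (\sum_k \sum_j \sum_l
      c k j * c' k l * (M k j * M k l * M j l) +
    \sum_k \sum_j (d' k * c k j - d k * c' k j) * M k j * (X 0 k * X 0 j))).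
  rewrite -big_split mulr_sumr; apply: eq_bigr => k _ /=; rewrite !mxE -/M.
  have -> : \sum_j \sum_l c k j * c' k l * (M k j * M k l * M j l) =
     (\sum_j c k j * M k j * X 0 j) * (\sum_l c' k l * M k l * Y 0 l)
     - (\sum_j c k j * M k j * Y 0 j) * (\sum_l c' k l * M k l * X 0 l).
    rewrite !big_distrlr -sumrB; apply: eq_bigr => j _ /=.
    by rewrite -sumrB; apply: eq_bigr => l _ /=; rewrite /M /rotation; ring.
  have -> : \sum_j (d' k * c k j - d k * c' k j) * M k j * (X 0 k * X 0 j) =
     X 0 k * (d' k * (\sum_j c k j * M k j * X 0 j)
              - d k * (\sum_j c' k j * M k j * X 0 j)).
    rewrite !mulr_sumr -sumrB mulr_sumr; apply: eq_bigr => j _; ring.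
  move: (\sum_j c k j * M k j * X 0 j) (\sum_j c' k j * M k j * X 0 j).
  move: (\sum_j c k j * M k j * Y 0 j) (\sum_j c' k j * M k j * Y 0 j) => *; ring.
rewrite sum3_antisym => [|k j l].
  rewrite sum2_antisym ?addr0 ?mulr0 // => i j; rewrite MC (cC j) (c'C j).
  have := pair i j => e; have {}e : d' i * c i j - d i * c' i j =
      d' j * c i j - d j * c' i j by lra.
  by rewrite e; ring.
rewrite -[RHS](mul0r (M k j * M k l * M j l)) -(triple k j l).
rewrite (MC k j) (MC k l) (MC j l); ring.
Qed.

(** The rotation [B] only mixes coordinates that have equal coefficients, so it is
a symmetry of the quadratic integral. *)
Lemma quad_lin_bracket c d B X Y : B^T = - B ->
  (forall i j, c i j = c j i) ->
  (forall i j k, B i j * c i k = B i j * c j k) ->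
  (forall i j, B i j * d i = B i j * d j) ->
  dotmul (Y *m B^T) (quad_grad_mom c X Y)
  - dotmul (quad_grad_pos c d X Y) (X *m B) = 0.
Proof.
move=> skB cC cB dB; set M := rotation X Y.
have BC i j : B j i = - B i j by have /matrixP/(_ i j) := skB; rewrite !mxE.
have MC i j : M j i = - M i j by exact: rotationC.
rewrite !dotmulE -sumrB.
transitivity (- 2 * (\sum_k \sum_j \sum_i c k j * B i k * (M k j * M i j) +
    \sum_k \sum_i d k * B i k * (X 0 i * X 0 k))).
  rewrite -big_split mulr_sumr; apply: eq_bigr => k _ /=; rewrite !mxE -/M.
  have -> : \sum_j \sum_i c k j * B i k * (M k j * M i j) =
     (\sum_j c k j * M k j * Y 0 j) * (\sum_i X 0 i * B i k)
     - (\sum_j c k j * M k j * X 0 j) * (\sum_i Y 0 i * B i k).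
    rewrite !big_distrlr -sumrB; apply: eq_bigr => j _ /=.
    by rewrite -sumrB; apply: eq_bigr => i _ /=; rewrite /M /rotation; ring.
  have -> : \sum_i d k * B i k * (X 0 i * X 0 k) = d k * X 0 k * (\sum_i X 0 i * B i k).
    by rewrite mulr_sumr; apply: eq_bigr => i _; ring.
  have -> : \sum_j Y 0 j * B^T j k = - \sum_j Y 0 j * B j k.
    by rewrite -sumrN; apply: eq_bigr => j _; rewrite mxE BC mulrN.
  move: (\sum_j c k j * M k j * X 0 j) (\sum_i X 0 i * B i k).
  move: (\sum_j c k j * M k j * Y 0 j) (\sum_i Y 0 i * B i k) => *; ring.
under eq_bigr do rewrite exchange_big /=.
rewrite sum2_antisym => [|i j].
  rewrite sum2_antisym ?addr0 ?mulr0 // => i j.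
  rewrite (BC i j).
  transitivity ((B i j * d j - B i j * d i) * (X 0 i * X 0 j)); first by ring.
  by rewrite dB subrr mul0r.
rewrite -big_split big1 // => l _ /=; rewrite (BC i j).
transitivity ((B i j * c j l - B i j * c i l) * (M i l * M j l)); first by ring.
by rewrite cB subrr mul0r.
Qed.

Lemma lin_lin_bracket B B' X Y : B^T = - B -> B'^T = - B' -> B *m B' = B' *m B ->
  dotmul (Y *m B'^T) (X *m B) - dotmul (Y *m B^T) (X *m B') = 0.
Proof.
move=> skB skB' BB'; rewrite (dotmul_mulmx Y) (dotmul_mulmx Y) !trmxK.
by rewrite -!mulmxA BB' subrr.
Qed.

End ambient_brackets.

(** * Divided differences with coinciding nodes *)

Section divided_differences.
Variable R : realType.
Implicit Types (al e : nat -> R) (a b k j l : nat).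

(** The limit for [t] tending to zero of the divided difference of [e + t * e'] with
respect to the perturbed nodes [al a - t * a]. The perturbation separates
coinciding nodes, which keeps enough integrals when [al] repeats a value. It
is a limit only when [e] is constant on the levels of [al]. *)
Definition two_level_quotient al e e' a b : R :=
  if al a == al b then (e' a - e' b) / (b%:R - a%:R)
  else (e a - e b) / (al a - al b).

Definition constant_on_levels al e := forall a b, al a = al b -> e a = e b.

Lemma two_level_quotientC al e e' a b :
  two_level_quotient al e e' a b = two_level_quotient al e e' b a.
Proof.
rewrite /two_level_quotient eq_sym; case: eqP => _.
  by rewrite -[e' a - e' b]opprB -[b%:R - a%:R]opprB invrN mulrNN.
by rewrite -[e a - e b]opprB -[al a - al b]opprB invrN mulrNN.
Qed.

Lemma two_level_quotient_diag al e e' a : two_level_quotient al e e' a a = 0.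
Proof. by rewrite /two_level_quotient eqxx subrr mul0r. Qed.

Lemma two_level_quotient_pair al e e' f f' a b :
  constant_on_levels al e -> constant_on_levels al f ->
  (f a - f b) * two_level_quotient al e e' a b =
  (e a - e b) * two_level_quotient al f f' a b.
Proof.
move=> le lf; rewrite /two_level_quotient; case: eqP => [ab|/eqP ab].
  by rewrite (le _ _ ab) (lf _ _ ab) !subrr !mul0r.
by rewrite mulrCA.
Qed.

Lemma two_level_quotient_metric al e e' a b : constant_on_levels al e ->
  (al a - al b) * two_level_quotient al e e' a b = e a - e b.
Proof.
move=> le; rewrite /two_level_quotient; case: eqP => [ab|/eqP ab].
  by rewrite (le _ _ ab) ab !subrr mul0r.
by rewrite mulrC divfK // subr_eq0.
Qed.

(** For honest divided differences both factors of each product are quotients of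
differences which sum to zero around the triangle [k, j, l], and the identity
holds by clearing denominators. If exactly two nodes coincide, then the
coefficients towards the third index agree and the terms cancel in pairs. *)
Lemma two_level_quotient_triple al e e' f f' k j l :
  constant_on_levels al e -> constant_on_levels al f ->
  let c := two_level_quotient al e e' in let c' := two_level_quotient al f f' in
  c k j * c' k l - c k l * c' k j + (c j l * c' j k - c j k * c' j l)
     + (c l k * c' l j - c l j * c' l k) = 0.
Proof.
move=> le lf c c'.
have cC a b : c a b = c b a by exact: two_level_quotientC.
have c'C a b : c' a b = c' b a by exact: two_level_quotientC.
rewrite (cC l k) (c'C l k) (cC l j) (c'C l j) (cC j k) (c'C j k).
have [->|kj] := eqVneq k j.
  by rewrite /c /c' !two_level_quotient_diag; ring.
have [->|kl] := eqVneq k l.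
  by rewrite /c /c' !two_level_quotient_diag (two_level_quotientC _ _ _ l)
    (two_level_quotientC _ f _ l); ring.
have [->|jl] := eqVneq j l.
  by rewrite /c /c' !two_level_quotient_diag; ring.
have ne a b : a != b -> b%:R - a%:R != 0 :> R.
  by move=> ab; rewrite subr_eq0 eqr_nat eq_sym.
have same a b m : al a = al b -> al b != al m -> c a m = c b m /\ c' a m = c' b m.
  move=> ab bm; rewrite /c /c' /two_level_quotient ab (negPf bm).
  by rewrite (le _ _ ab) (lf _ _ ab).
have [akj|akj] := eqVneq (al k) (al j).
  have [ajl|ajl] := eqVneq (al j) (al l); last first.
    by have [-> ->] := same _ _ _ akj ajl; ring.
  rewrite /c /c' /two_level_quotient akj ajl eqxx.
  have := ne _ _ kj; have := ne _ _ kl; have := ne _ _ jl.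
  move: (k%:R) (j%:R) (l%:R) => rk rj rl h1 h2 h3; field.
  by rewrite h1 h2 h3.
have [akl|akl] := eqVneq (al k) (al l).
  have lj : al l != al j by rewrite -akl.
  have [e1 e2] := same _ _ _ akl lj.
  by rewrite e1 e2 (cC l) (c'C l); ring.
have [ajl|ajl] := eqVneq (al j) (al l).
  have lk : al l != al k by rewrite eq_sym.
  have [e1 e2] := same _ _ _ ajl lk.
  by rewrite (cC k j) (c'C k j) e1 e2 (cC l) (c'C l); ring.
rewrite /c /c' /two_level_quotient (negPf akj) (negPf akl) (negPf ajl).
move: akj akl ajl; rewrite -!(subr_eq0 (al _)) => h1 h2 h3; field.
by rewrite h1 h2 h3.
Qed.

End divided_differences.

Section chain_rule.
Variables (R : realType) (m N : nat).
Variables X Y : 'rV[R]_m -> 'rV[R]_N.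
Hypotheses (rX : pole_free_row X) (rY : pole_free_row Y).

Lemma is_derive_bigsum I (f : 'I_I -> 'rV[R]_m -> R) df z v :
  (forall i, is_derive z v (f i) (df i)) ->
  is_derive z v (fun z => \sum_i f i z) (\sum_i df i).
Proof.
move=> Df; rewrite (_ : (fun z => _) = \sum_i f i); last first.
  by apply/funext => w; rewrite fct_sumE.
exact: is_derive_sum.
Qed.

Lemma is_derive_scale (a : R) (f : 'rV[R]_m -> R) df z v :
  is_derive z v f df -> is_derive z v (fun z => a * f z) (a * df).
Proof.
move=> Df; have Da : is_derive z v (fun=> a : R) 0 by exact: is_derive_cst.
by apply: (is_derive_eq (is_derive_mul Da Df)); rewrite mul0r add0r.
Qed.

Lemma is_derive_sqr (f : 'rV[R]_m -> R) df z v :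
  is_derive z v f df -> is_derive z v (fun z => f z ^+ 2) (2 * f z * df).
Proof.
move=> Df; apply: (is_derive_eq (is_derive_mul Df Df)).
ring.
Qed.

Lemma is_derive_entry (g : 'rV[R]_m -> 'rV[R]_N) z v i : pole_free_row g ->
  is_derive z v (fun z => g z 0 i) (row_derive g z v 0 i).
Proof. by move=> rg; rewrite row_deriveE; exact: pole_free_is_derive. Qed.

Lemma derive_quad_integral c d z v : (forall i j, c i j = c j i) ->
  'D_v (fun z => quad_integral c d (X z) (Y z)) z =
  dotmul (quad_grad_pos c d (X z) (Y z)) (row_derive X z v)
  + dotmul (quad_grad_mom c (X z) (Y z)) (row_derive Y z v).
Proof.
move=> cC; have DX i := is_derive_entry z v i rX.
have DY i := is_derive_entry z v i rY.
have DM i j : is_derive z v (fun z => rotation (X z) (Y z) i j) _ :=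
  is_deriveB (is_derive_mul (DX i) (DY j)) (is_derive_mul (DX j) (DY i)).
have D1 := is_derive_scale 2^-1 (is_derive_bigsum (fun i =>
  is_derive_bigsum (fun j => is_derive_scale (c i j) (is_derive_sqr (DM i j))))).
have D2 := is_derive_bigsum (fun i => is_derive_scale (d i) (is_derive_sqr (DX i))).
rewrite (is_deriveE (is_deriveD D1 D2)) /= {D1 D2 DM DX DY}.
move: (row_derive X z v) (row_derive Y z v) (X z) (Y z) => dX dY x y.
pose G i j := c i j * rotation x y i j * (dX 0 i * y 0 j - x 0 j * dY 0 i).
transitivity (\sum_i \sum_j G i j + \sum_i \sum_j G i j
    + \sum_i d i * (2 * x 0 i * dX 0 i)).
  congr (_ + _); rewrite mulr_sumr [in X in _ = _ + X]exchange_big -big_split.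
  apply: eq_bigr => i _ /=; rewrite mulr_sumr -big_split; apply: eq_bigr => j _ /=.
  by rewrite /G (rotationC x y i j) (cC j i); field.
rewrite !dotmulE -!big_split; apply: eq_bigr => k _ /=; rewrite !mxE.
have -> : \sum_j G k j = (\sum_j c k j * rotation x y k j * y 0 j) * dX 0 k
    - (\sum_j c k j * rotation x y k j * x 0 j) * dY 0 k.
  by rewrite !mulr_suml -sumrB; apply: eq_bigr => j _; rewrite /G; ring.
by move: (\sum_j _) (\sum_j _) => *; ring.
Qed.

Lemma derive_lin_integral B z v :
  'D_v (fun z => lin_integral B (X z) (Y z)) z =
  dotmul (Y z *m B^T) (row_derive X z v) + dotmul (X z *m B) (row_derive Y z v).
Proof.
have rXB : pole_free_row (fun z => X z *m B) by move=> i; exact: pole_free_mulmx.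
rewrite derive_dotmul // row_derive_mulmx //; congr (_ + _).
by rewrite dotmul_mulmx dotmulC.
Qed.

Lemma pole_free_rotation i j : pole_free (fun z => rotation (X z) (Y z) i j).
Proof.
apply: pole_freeD; first exact: pole_freeM.
by apply: pole_freeN; exact: pole_freeM.
Qed.

Lemma pole_free_quad_integral c d :
  pole_free (fun z => quad_integral c d (X z) (Y z)).
Proof.
apply: pole_freeD.
  apply: pole_freeM; first exact: pole_free_cst.
  apply: pole_free_sum => i; apply: pole_free_sum => j.
  apply: pole_freeM; first exact: pole_free_cst.
  by under eq_fun do rewrite expr2; apply: pole_freeM; exact: pole_free_rotation.
apply: pole_free_sum => i; apply: pole_freeM; first exact: pole_free_cst.
by under eq_fun do rewrite expr2; exact: pole_freeM.
Qed.

Lemma pole_free_lin_integral B : pole_free (fun z => lin_integral B (X z) (Y z)).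
Proof. by apply: pole_free_dotmul => // i; exact: pole_free_mulmx. Qed.


End chain_rule.

(** * Degree in the momenta *)

Section degree_in_momenta.
Variables (R : realType) (n : nat).
Implicit Types f g : 'rV[R]_(n + n) -> R.

Definition affine_in_momenta f :=
  exists (b : 'rV[R]_n -> 'I_n -> R) (c : 'rV[R]_n -> R),
    forall u p, f (row_mx u p) = \sum_i b u i * p 0 i + c u.

Definition at_most_quadratic_in_momenta f :=
  exists (a : 'rV[R]_n -> 'I_n -> 'I_n -> R) (b : 'rV[R]_n -> 'I_n -> R)
    (c : 'rV[R]_n -> R), forall u p, f (row_mx u p) =
      \sum_i \sum_j a u i j * p 0 i * p 0 j + \sum_i b u i * p 0 i + c u.

Lemma affine_basic (g : 'rV[R]_n -> R) : affine_in_momenta (fun z => g (lsubmx z)).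
Proof.
exists (fun _ _ => 0), g => u p.
by rewrite row_mxKl big1 ?add0r // => i _; rewrite mul0r.
Qed.

Lemma affineD f g : affine_in_momenta f -> affine_in_momenta g ->
  affine_in_momenta (fun z => f z + g z).
Proof.
move=> [b [c fE]] [b' [c' gE]].
exists (fun u i => b u i + b' u i), (fun u => c u + c' u) => u p.
rewrite fE gE addrACA -big_split /=; congr (_ + _).
by apply: eq_bigr => i _; rewrite mulrDl.
Qed.

Lemma affine_mull (g : 'rV[R]_n -> R) f : affine_in_momenta f ->
  affine_in_momenta (fun z => g (lsubmx z) * f z).
Proof.
move=> [b [c fE]]; exists (fun u i => g u * b u i), (fun u => g u * c u) => u p.
rewrite fE row_mxKl mulrDr mulr_sumr; congr (_ + _).
by apply: eq_bigr => i _; rewrite mulrA.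
Qed.

Lemma affine_sum (I : finType) (f : I -> 'rV[R]_(n + n) -> R) :
  (forall i, affine_in_momenta (f i)) -> affine_in_momenta (fun z => \sum_i f i z).
Proof.
move=> af; elim: (index_enum I) => [|i r IH].
  under eq_fun do rewrite big_nil; exact: (affine_basic (fun=> 0)).
under eq_fun do rewrite big_cons; exact: affineD.
Qed.

Lemma quadratic_affine f : affine_in_momenta f -> at_most_quadratic_in_momenta f.
Proof.
move=> [b [c fE]]; exists (fun _ _ _ => 0), b, c => u p.
rewrite fE [X in X + _ + _]big1 ?add0r // => i _.
by rewrite big1 // => j _; rewrite !mul0r.
Qed.

Lemma quadraticD f g : at_most_quadratic_in_momenta f ->
  at_most_quadratic_in_momenta g -> at_most_quadratic_in_momenta (fun z => f z + g z).
Proof.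
move=> [a [b [c fE]]] [a' [b' [c' gE]]].
exists (fun u i j => a u i j + a' u i j), (fun u i => b u i + b' u i),
  (fun u => c u + c' u) => u p.
rewrite fE gE addrACA; congr (_ + _).
rewrite addrACA; congr (_ + _); rewrite -big_split; apply: eq_bigr => i _ /=.
  by rewrite -big_split; apply: eq_bigr => j _; rewrite /= -!mulrDl.
by rewrite mulrDl.
Qed.

Lemma quadraticM f g : affine_in_momenta f -> affine_in_momenta g ->
  at_most_quadratic_in_momenta (fun z => f z * g z).
Proof.
move=> [b [c fE]] [b' [c' gE]].
exists (fun u i j => b u i * b' u j), (fun u i => c' u * b u i + c u * b' u i),
  (fun u => c u * c' u) => u p.
rewrite fE gE; have -> : \sum_i \sum_j b u i * b' u j * p 0 i * p 0 j =
    (\sum_i b u i * p 0 i) * (\sum_i b' u i * p 0 i).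
  by rewrite big_distrlr; apply: eq_bigr => i _; apply: eq_bigr => j _ /=; ring.
have -> : \sum_i (c' u * b u i + c u * b' u i) * p 0 i =
    c' u * (\sum_i b u i * p 0 i) + c u * (\sum_i b' u i * p 0 i).
  by rewrite !mulr_sumr -big_split; apply: eq_bigr => i _ /=; ring.
by move: (\sum_i _) (\sum_i _) => *; ring.
Qed.

Lemma quadratic_sum (I : finType) (f : I -> 'rV[R]_(n + n) -> R) :
  (forall i, at_most_quadratic_in_momenta (f i)) ->
  at_most_quadratic_in_momenta (fun z => \sum_i f i z).
Proof.
move=> af; elim: (index_enum I) => [|i r IH].
  under eq_fun do rewrite big_nil.
  exact: quadratic_affine (affine_basic (fun=> 0)).
under eq_fun do rewrite big_cons; exact: quadraticD.
Qed.

(** The first difference in the momenta isolates the linear part. *)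
Lemma linear_of_difference f u p : affine_in_momenta f ->
  f (row_mx u p) - f (row_mx u 0) != 0 -> linear_in_momenta f.
Proof.
move=> [b [c fE]] ne; exists b, c; split=> //; exists u, p.
move: ne; rewrite !fE [X in _ - (X + _)]big1 ?add0r ?addrK // => i _.
by rewrite mxE mulr0.
Qed.

(** The second difference in the momenta isolates the quadratic part. *)
Lemma quadratic_of_difference f u p : at_most_quadratic_in_momenta f ->
  f (row_mx u p) + f (row_mx u (- p)) - 2 * f (row_mx u 0) != 0 ->
  quadratic_in_momenta f.
Proof.
move=> [a [b [c fE]]] ne; exists a, b, c; split=> //; exists u, p.
apply: contraNneq ne => a0; rewrite !fE a0.
have -> : \sum_i \sum_j a u i j * (- p) 0 i * (- p) 0 j = 0.
  rewrite -[RHS]a0; apply: eq_bigr => i _; apply: eq_bigr => j _.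
  by rewrite !mxE; ring.
have -> : \sum_i b u i * (- p) 0 i = - \sum_i b u i * p 0 i.
  by rewrite -sumrN; apply: eq_bigr => i _; rewrite mxE mulrN.
have -> : \sum_i \sum_j a u i j * (0 : 'rV[R]_n) 0 i * (0 : 'rV[R]_n) 0 j = 0.
  by rewrite big1 // => i _; rewrite big1 // => j _; rewrite mxE mulr0 mul0r.
have -> : \sum_i b u i * (0 : 'rV[R]_n) 0 i = 0.
  by rewrite big1 // => i _; rewrite mxE mulr0.
by apply/eqP; move: (\sum_i _) => *; ring.
Qed.

Variables (A Q : 'M[R]_(n + 1)) (s : bool).
Let X z := position Q (cotangent_chart s z).
Let Y z := momentum A Q (cotangent_chart s z).

Definition fibre_momentum u (p : 'rV[R]_n) : 'rV[R]_(n + 1) :=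
  p *m invmx (metric s u) *m 'J (stereo s) u *m Q^T.

Lemma position_row u p : X (row_mx u p) = stereo s u *m Q^T.
Proof. by rewrite /X /position /= row_mxKl. Qed.

Lemma momentum_row u p :
  Y (row_mx u p) = fibre_momentum u p + stereo s u *m A *m Q^T.
Proof. by rewrite /Y /momentum /= row_mxKl row_mxKr mulmxDl. Qed.

Lemma affine_momentum i : affine_in_momenta (fun z => Y z 0 i).
Proof.
exists (fun u j => (invmx (metric s u) *m 'J (stereo s) u *m Q^T) j i),
  (fun u => (stereo s u *m A *m Q^T) 0 i) => u p.
rewrite momentum_row /fibre_momentum -!mulmxA mxE; congr (_ + _).
by rewrite mxE; apply: eq_bigr => j _; rewrite mulrC.
Qed.

Lemma affine_rotation i j : affine_in_momenta (fun z => rotation (X z) (Y z) i j).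
Proof.
have aX k : exists x : 'rV[R]_n -> R, forall z, X z 0 k = x (lsubmx z).
  by exists (fun u => (stereo s u *m Q^T) 0 k).
have [gi giE] := aX i; have [gj gjE] := aX j.
rewrite (_ : (fun z => _) =
  fun z => gi (lsubmx z) * Y z 0 j + (fun u => - gj u) (lsubmx z) * Y z 0 i).
  apply: affineD; first exact: (affine_mull gi (affine_momentum _)).
  exact: (affine_mull (fun u => - gj u) (affine_momentum _)).
by apply/funext => z; rewrite /rotation giE gjE mulNr.
Qed.

Lemma affine_lin_integral B : affine_in_momenta (fun z => lin_integral B (X z) (Y z)).
Proof.
under eq_fun do rewrite /lin_integral dotmulE; apply: affine_sum => i.
rewrite (_ : (fun z => _) =
  fun z => (fun u => (stereo s u *m Q^T *m B) 0 i) (lsubmx z) * Y z 0 i) //.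
exact: (affine_mull (fun u => (stereo s u *m Q^T *m B) 0 i) (affine_momentum _)).
Qed.

Lemma quadratic_quad_integral c d :
  at_most_quadratic_in_momenta (fun z => quad_integral c d (X z) (Y z)).
Proof.
apply: quadraticD.
  under eq_fun do rewrite mulr_sumr; apply: quadratic_sum => i.
  under eq_fun do rewrite mulr_sumr; apply: quadratic_sum => j.
  rewrite (_ : (fun z => _) = fun z => (fun=> 2^-1 * c i j) (lsubmx z) *
    rotation (X z) (Y z) i j * rotation (X z) (Y z) i j).
    apply: quadraticM; last exact: affine_rotation.
    exact: (affine_mull (fun=> 2^-1 * c i j) (affine_rotation _ _)).
  by apply/funext => z; rewrite expr2 !mulrA.
apply: quadratic_affine.
exact: (affine_basic (fun u => \sum_i d i * (stereo s u *m Q^T) 0 i ^+ 2)).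
Qed.

Lemma lin_integral_difference B u p :
  lin_integral B (X (row_mx u p)) (Y (row_mx u p))
  - lin_integral B (X (row_mx u 0)) (Y (row_mx u 0))
  = dotmul (stereo s u *m Q^T *m B) (fibre_momentum u p).
Proof.
rewrite /lin_integral !position_row !momentum_row /fibre_momentum !mul0mx add0r.
by rewrite dotmulDr addrK.
Qed.

Lemma quad_integral_difference c d u p :
  quad_integral c d (X (row_mx u p)) (Y (row_mx u p))
  + quad_integral c d (X (row_mx u (- p))) (Y (row_mx u (- p)))
  - 2 * quad_integral c d (X (row_mx u 0)) (Y (row_mx u 0))
  = \sum_i \sum_j c i j *
      rotation (stereo s u *m Q^T) (fibre_momentum u p) i j ^+ 2.
Proof.
rewrite !position_row !momentum_row /fibre_momentum !mul0mx add0r !mulNmx.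
move: (stereo s u *m Q^T) (p *m _ *m _ *m _) (_ *m A *m _) => x q r.
rewrite /quad_integral; set D := \sum_i d i * _.
transitivity (2^-1 * (\sum_i \sum_j c i j * rotation x (q + r) i j ^+ 2
   + \sum_i \sum_j c i j * rotation x (- q + r) i j ^+ 2
   - 2 * \sum_i \sum_j c i j * rotation x r i j ^+ 2)).
  by move: (\sum_i \sum_j _) (\sum_i \sum_j _) (\sum_i \sum_j _) D => *; ring.
rewrite mulr_sumr -big_split -sumrB mulr_sumr; apply: eq_bigr => i _ /=.
rewrite mulr_sumr -big_split -sumrB mulr_sumr; apply: eq_bigr => j _ /=.
by rewrite /rotation !mxE; field.
Qed.

End degree_in_momenta.

(** * The family of integrals *)

Section integral_family.
Variables (R : realType) (N : nat) (al : nat -> R).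
Implicit Types (h : R) (e f : nat -> R) (X Y : 'rV[R]_N).

(** The skew matrix that rotates the plane of coordinates [a.*2] and [a.*2.+1] with
speed [f a]. *)
Definition block_rotation f : 'M[R]_N :=
  \matrix_(i, j) ((f i./2 * ((i < j)%:R - (j < i)%:R)) *+ (i./2 == j./2)).

Definition pair_coef h e e' (i j : 'I_N) :=
  h + two_level_quotient al e e' i./2 j./2.

Definition potential_coef h e (i : 'I_N) := h * al i./2 + e i./2.

(** With [h = 1/2] and [e = e' = 0] this is the Neumann hamiltonian plus
rotations; with [h = 0] it is a combination of Uhlenbeck integrals, or of their
limits on the levels of [al], plus rotations. *)
Definition magnetic_integral h e e' f X Y :=
  quad_integral (pair_coef h e e') (potential_coef h e) X Y
  + lin_integral (block_rotation f) X Y.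

Definition integral_grad_pos h e e' f X Y :=
  quad_grad_pos (pair_coef h e e') (potential_coef h e) X Y
  + Y *m (block_rotation f)^T.

Definition integral_grad_mom h e e' f X Y :=
  quad_grad_mom (pair_coef h e e') X Y + X *m block_rotation f.

Lemma pair_coefC h e e' i j : pair_coef h e e' i j = pair_coef h e e' j i.
Proof. by rewrite /pair_coef two_level_quotientC. Qed.

Lemma block_rotation_skew f : (block_rotation f)^T = - block_rotation f.
Proof.
apply/matrixP => i j; rewrite !mxE eq_sym; case: eqP => [->|_].
  by rewrite !mulr1n; ring.
by rewrite !mulr0n oppr0.
Qed.

Lemma block_rotation_comm f f' :
  block_rotation f *m block_rotation f' = block_rotation f' *m block_rotation f.
Proof.
apply/matrixP => i j; rewrite !mxE; apply: eq_bigr => k _; rewrite !mxE.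
case: (i./2 =P k./2) => [->|_]; last by rewrite !mulr0n !mul0r.
by case: eqP => _; rewrite ?mulr1n ?mulr0n ?mulr0 //; ring.
Qed.

(** All conditions for commutation are bilinear in the pair of coefficient
functions, so the constant part [h] and the divided differences combine. *)
Lemma integral_bracket h1 e1 e1' f1 h2 e2 e2' f2 X Y :
  constant_on_levels al e1 -> constant_on_levels al e2 ->
  dotmul (integral_grad_pos h2 e2 e2' f2 X Y) (integral_grad_mom h1 e1 e1' f1 X Y)
  - dotmul (integral_grad_pos h1 e1 e1' f1 X Y) (integral_grad_mom h2 e2 e2' f2 X Y)
  = 0.
Proof.
move=> le1 le2.
have QQ : dotmul (quad_grad_pos (pair_coef h2 e2 e2') (potential_coef h2 e2) X Y)
      (quad_grad_mom (pair_coef h1 e1 e1') X Y)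
    - dotmul (quad_grad_pos (pair_coef h1 e1 e1') (potential_coef h1 e1) X Y)
      (quad_grad_mom (pair_coef h2 e2 e2') X Y) = 0.
  apply: quad_quad_bracket; [exact: pair_coefC|exact: pair_coefC| |].
  - move=> k j l; rewrite /pair_coef.
    have := two_level_quotient_triple e1' e2' k./2 j./2 l./2 le1 le2.
    rewrite /= !(two_level_quotientC al _ _ l./2) (two_level_quotientC al e1 _ j./2 k./2).
    rewrite (two_level_quotientC al e2 _ j./2 k./2) => H.
    rewrite -[RHS]H; ring.
  - move=> k j; rewrite /pair_coef /potential_coef.
    have P := two_level_quotient_pair e1' e2' k./2 j./2 le1 le2.
    have M1 := two_level_quotient_metric e1' k./2 j./2 le1.
    have M2 := two_level_quotient_metric e2' k./2 j./2 le2.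
    move: P M1 M2; move: (two_level_quotient al e1 _ _ _) (two_level_quotient al e2 _ _ _).
    move: (al k./2) (al j./2) (e1 k./2) (e1 j./2) (e2 k./2) (e2 j./2).
    move=> a b p q r t x y P M1 M2.
    have -> : (h2 * a + r - (h2 * b + t)) * (h1 + x) =
       h1 * h2 * (a - b) + h2 * ((a - b) * x) + h1 * (r - t) + (r - t) * x by ring.
    have -> : (h1 * a + p - (h1 * b + q)) * (h2 + y) =
       h1 * h2 * (a - b) + h1 * ((a - b) * y) + h2 * (p - q) + (p - q) * y by ring.
    by rewrite P M1 M2; ring.
have QL h e e' f : dotmul (Y *m (block_rotation f)^T) (quad_grad_mom (pair_coef h e e') X Y)
    - dotmul (quad_grad_pos (pair_coef h e e') (potential_coef h e) X Y)
       (X *m block_rotation f) = 0.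
  apply: quad_lin_bracket; [exact: block_rotation_skew|exact: pair_coefC| |].
  - move=> i j k; rewrite mxE /pair_coef.
    by case: eqP => [->|_] //; rewrite mulr0n !mul0r.
  - move=> i j; rewrite mxE /potential_coef.
    by case: eqP => [->|_] //; rewrite mulr0n !mul0r.
have LL := @lin_lin_bracket _ _ _ _ X Y (block_rotation_skew f1)
  (block_rotation_skew f2) (block_rotation_comm f1 f2).
have QL1 := QL h1 e1 e1' f2; have QL2 := QL h2 e2 e2' f1.
rewrite /integral_grad_pos /integral_grad_mom !(dotmulDl, dotmulDr).
move: QQ QL1 QL2 LL; clear QL; do 8 move: (dotmul _ _); move=> *; lra.
Qed.

Lemma position_integral_grad_mom h e e' f X Y :
  dotmul X (integral_grad_mom h e e' f X Y) = 0.
Proof.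
rewrite dotmulDr position_quad_grad_mom; last exact: pair_coefC.
by rewrite add0r skew_dot0 //; exact: block_rotation_skew.
Qed.

Lemma lagrange_identity X Y :
  \sum_i \sum_j rotation X Y i j ^+ 2 =
  2 * (dotmul X X * dotmul Y Y - dotmul X Y ^+ 2).
Proof.
rewrite expr2 !dotmulE !big_distrlr -sumrB mulr_sumr.
transitivity (\sum_i \sum_j (X 0 i ^+ 2 * Y 0 j ^+ 2 - X 0 i * Y 0 i * (X 0 j * Y 0 j))
  + \sum_i \sum_j (X 0 i ^+ 2 * Y 0 j ^+ 2 - X 0 i * Y 0 i * (X 0 j * Y 0 j))).
  rewrite [X in _ = _ + X]exchange_big -big_split; apply: eq_bigr => i _.
  by rewrite -big_split; apply: eq_bigr => j _ /=; rewrite /rotation; ring.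
rewrite -big_split; apply: eq_bigr => i _; rewrite -big_split -sumrB mulr_sumr.
by apply: eq_bigr => j _ /=; ring.
Qed.

End integral_family.

Section hamiltonian.
Variables (R : realType) (n : nat) (A Q : 'M[R]_(n + 1)) (lam : nat -> R).
Hypotheses (skA : A^T = - A) (QQ : Q *m Q^T = 1%:M).
Hypothesis normal_form : Q *m A *m Q^T = block_rotation (n + 1) lam.
Hypothesis eigen : forall i, row i Q *m A *m A^T = lam i./2 ^+ 2 *: row i Q.

Definition potential (a : nat) : R := lam a ^+ 2.

Definition kinetic_energy (c : cotangent_sphere R n) : R :=
  2^-1 * dotmul (sval c).2 (sval c).2.

Lemma hamiltonianE s : hamiltonian s = in_chart kinetic_energy s.
Proof.
apply/funext => z; rewrite /hamiltonian /in_chart /kinetic_energy; congr (_ * _).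
rewrite /= (gram_pairing _ _ (metric_unit s (lsubmx z))) -/(metric s (lsubmx z)).
rewrite dotmulE exchange_big; apply: eq_bigr => j _; rewrite [X in _ = _ * X]mxE mulr_sumr.
by apply: eq_bigr => i _; ring.
Qed.

Lemma field_norm x : dotmul (x *m A) (x *m A) =
  \sum_(i < n + 1) potential i./2 * (x *m Q^T) 0 i ^+ 2.
Proof.
set X := x *m Q^T; have xE : x = X *m Q by rewrite -mulmxA (mulmx1C QQ) mulmx1.
rewrite dotmul_mulmx dotmulC [in dotmul (x *m _ *m _)]xE (mulmx_sum_row X) !mulmx_suml.
have -> : \sum_i X 0 i *: row i Q *m A *m A^T =
    (\row_i (X 0 i * potential i./2)) *m Q.
  rewrite (mulmx_sum_row (\row_i _)); apply: eq_bigr => i _.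
  by rewrite -!scalemxAl eigen scalerA mxE.
rewrite dotmul_mulmx dotmulE; apply: eq_bigr => i _.
by rewrite mxE -/X; ring.
Qed.

(** Completing the square: the shift by [x A] turns the magnetic term into a
rotation and a quadratic potential. *)
Lemma kinetic_energy_integral (c : cotangent_sphere R n) : kinetic_energy c =
  magnetic_integral potential 2^-1 (fun=> 0) (fun=> 0) (fun a => - lam a)
    (position Q c) (momentum A Q c).
Proof.
rewrite /magnetic_integral.
have XX := position_unit QQ c; have XY := position_momentum skA QQ c.
have -> : quad_integral (pair_coef potential 2^-1 (fun=> 0) (fun=> 0))
    (potential_coef potential 2^-1 (fun=> 0)) (position Q c) (momentum A Q c) =
    2^-1 * dotmul (momentum A Q c) (momentum A Q c)
    + 2^-1 * dotmul ((sval c).1 *m A) ((sval c).1 *m A).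
  rewrite /quad_integral field_norm; congr (_ + _); last first.
    rewrite mulr_sumr; apply: eq_bigr => i _; rewrite /potential_coef /position.
    by ring.
  have := lagrange_identity (position Q c) (momentum A Q c).
  rewrite XX XY expr0n /= subr0 mul1r => L; congr (_ * _).
  rewrite -[RHS](mulKf (_ : 2 != 0 :> R)) // -L mulr_sumr.
  apply: eq_bigr => i _; rewrite mulr_sumr; apply: eq_bigr => j _.
  by rewrite /pair_coef /two_level_quotient !subrr !mul0r if_same addr0.
have -> : block_rotation (n + 1) (fun a => - lam a) = - block_rotation (n + 1) lam.
  by apply/matrixP => i j; rewrite !mxE mulNr mulNrn.
rewrite -normal_form /lin_integral mulmxN /position /momentum /kinetic_energy.
case: c {XX XY} => -[x y] /= _.
have -> : x *m Q^T *m (Q *m A *m Q^T) = x *m A *m Q^T.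
  by rewrite !mulmxA -(mulmxA x) (mulmx1C QQ) mulmx1.
move: (x *m A) => w.
rewrite [dotmul (- _) _]dotmulC dotmulNr !dotmul_rot // !(dotmulDl, dotmulDr) (dotmulC w y).
by field.
Qed.

End hamiltonian.

(** * Independence at a test point *)

Section independence.
Variables (R : realType) (N : nat) (al : nat -> R).
Hypothesis alS : forall a, al a.+1 <= al a.
Implicit Types (h rho mu : R) (e f : nat -> R).

Lemma nonincreasing_levels a b : (a <= b)%N -> al b <= al a.
Proof.
elim: b => [|b IH]; first by rewrite leqn0 => /eqP ->.
by rewrite leq_eqVlt => /predU1P[-> //|/IH]; exact: le_trans (alS b).
Qed.

(** The profile of the momenta at the test point. When [al] is nonincreasing, its
differences have the sign of the denominators of both kinds of divided
differences, those between different levels and those inside a level. *)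
Definition tilt (a : nat) : R := a%:R - al a.

Definition test_position rho : 'rV[R]_N := \row_i (rho * (~~ odd i)%:R).

Definition test_momentum rho mu : 'rV[R]_N :=
  \row_i (rho * (tilt i./2 - mu) * (~~ odd i)%:R).

Lemma rotation_test rho mu i j :
  rotation (test_position rho) (test_momentum rho mu) i j =
  rho ^+ 2 * (tilt j./2 - tilt i./2) * ((~~ odd i)%:R * (~~ odd j)%:R).
Proof. by rewrite /rotation !mxE; ring. Qed.

Lemma even_half i : ~~ odd i -> i = i./2.*2 :> nat.
Proof. by move=> oi; rewrite even_halfK. Qed.

Lemma test_position_rotation f rho (k : 'I_N) : odd k ->
  (test_position rho *m block_rotation N f) 0 k = rho * f k./2.
Proof.
move=> ok; have kE : k = k./2.*2.+1 :> nat by rewrite -[LHS]odd_double_half ok.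
have lt_k : (k./2.*2 < k)%N by rewrite [ltnRHS]kE.
have kN : (k./2.*2 < N)%N := ltn_trans lt_k (ltn_ord k).
rewrite mxE (bigD1 (Ordinal kN)) //= big1 ?addr0 => [|j jk].
  rewrite !mxE /= odd_double doubleK eqxx mulr1n lt_k.
  by rewrite ltnNge ltnW //= subr0 !mulr1.
rewrite !mxE; have [oj|oj] := boolP (odd j); first by rewrite mulr0 mul0r.
case: eqP => [jk2|_]; last by rewrite mulr0n mulr0.
by case/eqP: jk; apply: val_inj; rewrite /= -jk2; exact: even_half.
Qed.

Lemma grad_mom_odd h e e' f rho mu (k : 'I_N) : odd k ->
  integral_grad_mom al h e e' f (test_position rho) (test_momentum rho mu) 0 k
  = rho * f k./2.
Proof.
move=> ok; rewrite mxE test_position_rotation // mxE big1 ?mulr0 ?add0r // => j _.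
by rewrite rotation_test ok /= mul0r !mulr0 mul0r.
Qed.

Lemma grad_mom_even h e e' f rho mu (k : 'I_N) : ~~ odd k ->
  integral_grad_mom al h e e' f (test_position rho) (test_momentum rho mu) 0 k
  = - 2 * rho ^+ 3 *
    \sum_j pair_coef al h e e' k j * ((tilt j./2 - tilt k./2) * (~~ odd j)%:R).
Proof.
move=> ek; rewrite mxE [X in X + _]mxE [X in _ + X]mxE [X in _ + X]big1 ?addr0.
  rewrite -mulrA; congr (_ * _); rewrite mulr_sumr; apply: eq_bigr => j _.
  rewrite rotation_test ek mxE; case: (odd j) => /=; rewrite ?mulr0 ?mul0r //; ring.
move=> j _; rewrite !mxE; have [oj|oj] := boolP (odd j); first by rewrite mulr0 mul0r.
case: eqP => [jk|_]; last by rewrite mulr0n mulr0.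
have -> : j = k by apply: val_inj; rewrite /= (even_half oj) jk -even_half.
by rewrite subrr mulr0 mulr1n mulr0.
Qed.

Lemma sum2_ge0_eq0 (a : 'I_N -> 'I_N -> R) : (forall i j, 0 <= a i j) ->
  \sum_i \sum_j a i j = 0 -> forall i j, a i j = 0.
Proof.
move=> a0 /eqP; rewrite psumr_eq0 => [/allP H i j|i _]; last exact: sumr_ge0.
have := H i (mem_index_enum _); rewrite /= psumr_eq0 // => /allP/(_ j (mem_index_enum _)).
by move/eqP.
Qed.

(** Pairing the momentum gradient with a test vector [T] and symmetrising over
the two indices leaves only differences of [T]. When [c] is a divided difference
of [T] and [t] is the tilt, all terms have the same sign. *)
Lemma test_pairing (c : 'I_N -> 'I_N -> R) (t T : 'I_N -> R) :
  (forall i j, c i j = c j i) ->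
  (forall k : 'I_N, ~~ odd k -> \sum_j c k j * ((t j - t k) * (~~ odd j)%:R) = 0) ->
  \sum_(k < N) \sum_(j < N) (~~ odd k)%:R * (~~ odd j)%:R *
    (c k j * (t j - t k) * (T k - T j)) = 0.
Proof.
move=> cC c0; pose a (k j : 'I_N) := (~~ odd k)%:R * T k * (c k j * ((t j - t k) * (~~ odd j)%:R)).
have a0 : \sum_k \sum_j a k j = 0.
  rewrite big1 // => k _; rewrite -mulr_sumr; have [ok|ek] := boolP (odd k).
    by rewrite !mul0r.
  by rewrite c0 // mulr0.
transitivity (\sum_k \sum_j a k j + \sum_k \sum_j a k j); last by rewrite a0 addr0.
rewrite [X in _ = _ + X]exchange_big -big_split; apply: eq_bigr => k _ /=.
by rewrite -big_split; apply: eq_bigr => j _ /=; rewrite /a (cC j k); ring.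
Qed.

(** At the test point all odd coordinates vanish, so rotations are seen by the odd
components of the momentum gradient and divided differences by the even ones. The
pairing lemma is used with two test vectors: first the numerator between
different levels, which must then agree on any two of them, and next the numerator
inside the levels. *)
Lemma momentum_gradient_kernel h e e' f rho mu : rho != 0 ->
  constant_on_levels al e ->
  integral_grad_mom al h e e' f (test_position rho) (test_momentum rho mu) = 0 ->
  (forall a, (a.*2.+1 < N)%N -> f a = 0) /\
  (forall a, (a.+1.*2 < N)%N ->
     if al a == al a.+1 then h + (e' a - e' a.+1) = 0
     else h * (al a - al a.+1) + (e a - e a.+1) = 0).
Proof.
move=> rho0 le /rowP g0; split=> [a aN|].
  have := g0 (Ordinal aN); rewrite grad_mom_odd /= ?odd_double // mxE => /eqP.
  by rewrite mulf_eq0 (negPf rho0) uphalf_double => /eqP.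
pose c : 'I_N -> 'I_N -> R := pair_coef al h e e'; pose t (j : 'I_N) := tilt j./2.
have cC i j : c i j = c j i by exact: pair_coefC.
have c0 (k : 'I_N) : ~~ odd k -> \sum_j c k j * ((t j - t k) * (~~ odd j)%:R) = 0.
  move=> ek; have := g0 k; rewrite grad_mom_even // mxE => /eqP.
  by rewrite mulf_eq0 mulf_eq0 oppr_eq0 pnatr_eq0 expf_eq0 (negPf rho0) => /eqP.
pose T1 (i : 'I_N) := h * al i./2 + e i./2.
pose T2 (i : 'I_N) := e' i./2 - h * (i./2)%:R.
have term1 k j : c k j * (t j - t k) * (T1 k - T1 j) =
    if al k./2 == al j./2 then 0
    else (T1 k - T1 j) ^+ 2 * (1 + ((j./2)%:R - (k./2)%:R) / (al k./2 - al j./2)).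
  rewrite /c /pair_coef /two_level_quotient /T1 /t /tilt.
  case: eqP => [kj|/eqP kj]; first by rewrite kj (le _ _ kj) subrr mulr0.
  by field; rewrite subr_eq0.
have pos k j : al k != al j -> 0 <= (j%:R - k%:R) / (al k - al j).
  move=> kj; case/orP: (leq_total k j) => le_kj.
    by rewrite divr_ge0 // subr_ge0 ?ler_nat // nonincreasing_levels.
  by rewrite -mulrNN -invrN !opprB divr_ge0 // subr_ge0 ?ler_nat // nonincreasing_levels.
have zero1 := sum2_ge0_eq0 _ (test_pairing T1 cC c0).
have {}zero1 (k j : 'I_N) : ~~ odd k -> ~~ odd j -> al k./2 != al j./2 -> T1 k = T1 j.
  move=> ek ej kj.
  have := zero1 _ k j; rewrite ek ej term1 (negPf kj) !mul1r => H.
  apply/eqP; rewrite -subr_eq0 -sqrf_eq0.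
  have : (T1 k - T1 j) ^+ 2 * (1 + (j./2%:R - k./2%:R) / (al k./2 - al j./2)) == 0.
    apply/eqP; apply: H => i l; rewrite term1 !mulr_ge0 ?ler0n //.
    by case: ifP => // /negbT il; rewrite mulr_ge0 ?sqr_ge0 // addr_ge0 ?pos.
  by rewrite mulf_eq0 [X in _ || X]gt_eqF ?orbF // ltr_pwDl ?ltr01 ?pos.
have term2 (k j : 'I_N) : ~~ odd k -> ~~ odd j ->
   c k j * (t j - t k) * (T2 k - T2 j) =
    if al k./2 == al j./2 then (T2 k - T2 j) ^+ 2 else 0.
  move=> ek ej; case: (eqVneq (al k./2) (al j./2)) => kj; last first.
    have := zero1 _ _ ek ej kj; rewrite /c /pair_coef /two_level_quotient (negPf kj) /T1.
    move=> H; have -> : e k./2 - e j./2 = - h * (al k./2 - al j./2) by lra.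
    by rewrite mulfK ?subr_eq0 // subrr !mul0r.
  rewrite /c /pair_coef /two_level_quotient kj eqxx /T2 /t /tilt kj.
  have [->|jk] := eqVneq k./2 j./2; first by rewrite !subrr; ring.
  by field; rewrite subr_eq0 eqr_nat eq_sym.
have zero2 (k j : 'I_N) : ~~ odd k -> ~~ odd j -> al k./2 = al j./2 -> T2 k = T2 j.
  move=> ek ej kj.
  have := sum2_ge0_eq0 _ (test_pairing T2 cC c0) k j.
  rewrite ek ej term2 // kj eqxx !mul1r => H.
  apply/eqP; rewrite -subr_eq0 -sqrf_eq0; apply/eqP; apply: H => i l.
  have [oi|ei] := boolP (odd i); first by rewrite !mul0r.
  have [ol|el] := boolP (odd l); first by rewrite mulr0 !mul0r.
  by rewrite !mul1r term2 //; case: ifP => // _; rewrite sqr_ge0.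
move=> a aN; have aN' : (a.*2 < N)%N by rewrite (leq_trans _ aN) // ltnS leq_double.
pose i := Ordinal aN'; pose j := Ordinal aN.
have ei : ~~ odd i by rewrite /= odd_double.
have ej : ~~ odd j by rewrite /= odd_double.
have ia : i./2 = a by rewrite /= doubleK.
have ja : j./2 = a.+1 by rewrite [j./2]doubleK.
case: eqP => [aa|/eqP aa].
  have := zero2 i j ei ej; rewrite /T2 ia ja => /(_ aa).
  by rewrite -natr1 => H; lra.
by have := zero1 i j ei ej; rewrite /T1 ia ja => /(_ aa) H; lra.
Qed.

End independence.

Section generic_independence.
Variables (R : realType) (n : nat) (A Q : 'M[R]_(n + 1)) (al : nat -> R).
Hypothesis QQ : Q *m Q^T = 1%:M.
Variable s : bool.

Let X z := position Q (cotangent_chart s z).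
Let Y z := momentum A Q (cotangent_chart s z).

Lemma stereo_antipode u : stereo (~~ s) u = - stereo s (- u) :> 'rV[R]_(n + 1).
Proof.
have uu : dotmul (- u) (- u) = dotmul u u.
  by rewrite -scaleN1r dotmulZl dotmulZr !mulN1r opprK.
rewrite /stereo uu -scalerN opp_row_mx scalerN opprK; congr (_ *: row_mx _ _).
by case: s => /=; apply/matrixP => i j; rewrite !mxE -mulNrn; congr (_ *+ _); ring.
Qed.

Lemma stereo_or_antipode (x : 'rV[R]_(n + 1)) : dotmul x x = 1 ->
  exists u, stereo s u = x \/ stereo s u = - x.
Proof.
move=> /stereo_cover[s' [u ux]]; have [ss|ss] := eqVneq s' s.
  by exists u; left; rewrite -ss.
exists (- u); right; rewrite -ux (_ : s' = ~~ s) ?stereo_antipode ?opprK //.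
by case: s' s ss {ux} => -[].
Qed.

(** The chart misses one point of the sphere; if this is the test position, then its
antipode is used. *)
Lemma exists_test_chart : exists u rho mu, [/\ rho != 0,
  stereo s u *m Q^T = test_position (n + 1) rho &
  dotmul (test_position (n + 1) rho) (test_momentum (n + 1) al rho mu) = 0].
Proof.
pose S : R := \sum_(i < n + 1) (~~ odd i)%:R.
have S0 : 0 < S.
  have n1 : (0 < n + 1)%N by rewrite addn1.
  rewrite /S (bigD1 (Ordinal n1)) //= ltr_pwDl ?ltr01 //.
  by apply: sumr_ge0 => i _; exact: ler0n.
have sq (b : bool) : b%:R * b%:R = b%:R :> R by case: b; rewrite ?mulr1 ?mulr0.
pose mu := S^-1 * \sum_(i < n + 1) tilt al i./2 * (~~ odd i)%:R.
have XY rho : dotmul (test_position (n + 1) rho) (test_momentum (n + 1) al rho mu) = 0.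
  rewrite dotmulE (_ : \sum_i _ = rho ^+ 2 *
     (\sum_(i < n + 1) tilt al i./2 * (~~ odd i)%:R - mu * S)); last first.
    rewrite /S mulr_sumr -sumrB mulr_sumr; apply: eq_bigr => i _; rewrite !mxE.
    by rewrite -[in RHS](sq (~~ odd i)); ring.
  by rewrite (mulrC mu) mulVKf ?gt_eqF // subrr mulr0.
have XX rho : dotmul (test_position (n + 1) rho) (test_position (n + 1) rho) = rho ^+ 2 * S.
  rewrite dotmulE mulr_sumr; apply: eq_bigr => i _; rewrite !mxE.
  by rewrite -[in RHS](sq (~~ odd i)); ring.
pose rho := (Num.sqrt S)^-1.
have rho0 : rho != 0 by rewrite invr_eq0 sqrtr_eq0 -ltNge.
have [|u ux] := @stereo_or_antipode (test_position (n + 1) rho *m Q).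
  rewrite -[Q]trmxK dotmul_rot ?trmxK ?(mulmx1C QQ) // XX.
  by rewrite exprVn sqr_sqrtr ?ltW // mulVf ?gt_eqF.
have QK (x : 'rV[R]_(n + 1)) : x *m Q *m Q^T = x by rewrite -mulmxA QQ mulmx1.
case: ux => uE; [exists u, rho, mu|exists u, (- rho), mu]; split; rewrite ?oppr_eq0 // uE.
  by rewrite QK.
by rewrite mulNmx QK; apply/rowP => i; rewrite !mxE mulNr.
Qed.

Lemma fibre_momentum_onto u b : dotmul (stereo s u *m Q^T) b = 0 ->
  exists p, fibre_momentum Q s u p = b.
Proof.
move=> ub; have bE : b = b *m Q *m Q^T by rewrite -mulmxA QQ mulmx1.
have [|a aE] := @tangent_space _ _ s u (b *m Q).
  by rewrite dotmulC -(dotmul_rot _ _ QQ) -bE.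
exists (a *m metric s u); rewrite /fibre_momentum mulmxK ?metric_unit //.
by rewrite -aE -bE.
Qed.

Lemma dotmul_sumZ m k (v : 'I_k -> R) (w : 'I_k -> 'rV[R]_m) r :
  dotmul (\sum_i v i *: w i) r = \sum_i v i * dotmul (w i) r.
Proof.
rewrite /dotmul mulmx_suml summxE; apply: eq_bigr => i _.
by rewrite -scalemxAl mxE.
Qed.

Section family.
Variables (k : nat) (h : 'I_k -> R) (e e' f : 'I_k -> nat -> R).
Hypothesis le : forall i, constant_on_levels al (e i).

Let F i z := magnetic_integral al (h i) (e i) (e' i) (f i) (X z) (Y z).

Lemma pole_free_integral i : pole_free (F i).
Proof.
have rX := pole_free_position Q s; have rY := pole_free_momentum A Q s.
by apply: pole_freeD; [exact: pole_free_quad_integral|exact: pole_free_lin_integral].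
Qed.

Lemma derive_integral i z v : 'D_v (F i) z =
  dotmul (integral_grad_pos al (h i) (e i) (e' i) (f i) (X z) (Y z)) (row_derive X z v)
  + dotmul (integral_grad_mom al (h i) (e i) (e' i) (f i) (X z) (Y z)) (row_derive Y z v).
Proof.
have rX := pole_free_position Q s; have rY := pole_free_momentum A Q s.
have Dq := pole_free_is_derive z v (pole_free_quad_integral rX rY
  (pair_coef al (h i) (e i) (e' i)) (potential_coef al (h i) (e i))).
have Dl := pole_free_is_derive z v (pole_free_lin_integral rX rY
  (block_rotation (n + 1) (f i))).
rewrite [LHS](is_deriveE (is_deriveD Dq Dl)).
rewrite (derive_quad_integral rX rY); last exact: pair_coefC.
by rewrite (derive_lin_integral rX rY) addrACA -!dotmulDl.
Qed.

Lemma poisson_integral i j z : poisson A s (F i) (F j) z = 0.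
Proof.
rewrite (poisson_embedding QQ _ _ (derive_integral i z) (derive_integral j z)).
- exact: integral_bracket.
- exact: pole_free_differentiable (pole_free_integral i) z.
- exact: pole_free_differentiable (pole_free_integral j) z.
- exact: position_integral_grad_mom.
- exact: position_integral_grad_mom.
Qed.

Lemma integral_grad_mom_sum (v : 'I_k -> R) (x y : 'rV[R]_(n + 1)) :
  \sum_i v i *: integral_grad_mom al (h i) (e i) (e' i) (f i) x y =
  integral_grad_mom al (\sum_i v i * h i) (fun a => \sum_i v i * e i a)
    (fun a => \sum_i v i * e' i a) (fun a => \sum_i v i * f i a) x y.
Proof.
have cE (a b : 'I_(n + 1)) : pair_coef al (\sum_i v i * h i)
    (fun a => \sum_i v i * e i a) (fun a => \sum_i v i * e' i a) a b =
    \sum_i v i * pair_coef al (h i) (e i) (e' i) a b.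
  rewrite /pair_coef /two_level_quotient; case: eqP => _;
  by rewrite -sumrB mulr_suml -big_split; apply: eq_bigr => i _ /=; ring.
have BE : block_rotation (n + 1) (fun a => \sum_i v i * f i a) =
    \sum_i v i *: block_rotation (n + 1) (f i).
  apply/matrixP => a b; rewrite summxE !mxE mulr_suml -sumrMnl.
  by apply: eq_bigr => i _; rewrite !mxE -mulrA mulrnAr.
rewrite /integral_grad_mom BE mulmx_sumr.
under eq_bigr do rewrite scalerDr; rewrite big_split; congr (_ + _); last first.
  by apply: eq_bigr => i _; rewrite scalemxAr.
apply/rowP => l; rewrite summxE !mxE; under eq_bigr do rewrite !mxE mulrCA.
rewrite -mulr_sumr; congr (_ * _).
under [RHS]eq_bigr do rewrite cE !mulr_suml.
rewrite exchange_big; apply: eq_bigr => j _; rewrite mulr_sumr.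
by apply: eq_bigr => i _; rewrite /= !mulrA.
Qed.

Definition gradient_matrix z := \matrix_(i < k) gradient (F i) z.

(** Along the fibres only the momentum gradients matter. *)
Lemma row_free_gradient z :
  (forall v : 'I_k -> R,
    integral_grad_mom al (\sum_i v i * h i) (fun a => \sum_i v i * e i a)
      (fun a => \sum_i v i * e' i a) (fun a => \sum_i v i * f i a) (X z) (Y z) = 0 ->
    forall i, v i = 0) ->
  row_free (gradient_matrix z).
Proof.
move=> H; rewrite -kermx_eq0; apply/rowV0P => v /sub_kermxP vG.
apply/rowP => i; rewrite mxE; apply: (H (v 0)); rewrite -integral_grad_mom_sum.
have Xg : dotmul (X z) (\sum_i v 0 i *:
    integral_grad_mom al (h i) (e i) (e' i) (f i) (X z) (Y z)) = 0.
  by rewrite integral_grad_mom_sum; exact: position_integral_grad_mom.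
apply: (@vertical_separates _ _ A Q QQ s z _ Xg) => q.
have : dotmul (v *m gradient_matrix z) (row_mx 0 q) = 0.
  by rewrite vG dotmulC dotmul0.
rewrite mulmx_sum_row !dotmul_sumZ => G0; rewrite -[RHS]G0; apply: eq_bigr => j _; congr (_ * _).
rewrite rowK -derive_gradient; last exact: pole_free_differentiable (pole_free_integral j) z.
by rewrite derive_integral row_derive_position_vertical dotmul0 add0r.
Qed.

End family.
End generic_independence.

(** * Generic independence and the choice of integrals *)

Section almost_everywhere.
Variable R : realType.

(** The Gram determinant turns full rank into the nonvanishing of one function. *)
Lemma gram_unit k m (G : 'M[R]_(k, m)) : row_free G -> G *m G^T \in unitmx.
Proof.
move=> fG; rewrite -row_free_unit -kermx_eq0; apply/rowV0P => v /sub_kermxP vGG.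
have vG : v *m G = 0.
  by apply: dotmul_eq0; rewrite dotmul_mulmx -mulmxA vGG dotmul0.
by move/row_freeP: fG => [B GB]; rewrite -[v]mulmx1 -GB mulmxA vG mul0mx.
Qed.

Lemma pole_free_row_free_ae m k (G : 'rV[R]_m -> 'M[R]_(k, m)) :
  (forall i j, pole_free (fun z => G z i j)) -> (exists z, row_free (G z)) ->
  {ae lebesgue_tuple R m, forall t, row_free (G (row_of_tuple t))}.
Proof.
move=> rG [z0 fG0]; pose D z := \det (G z *m (G z)^T).
have rD : pole_free D.
  apply: pole_free_det => i j; under eq_fun do rewrite mxE.
  apply: pole_free_sum => l; apply: pole_freeM => //.
  by under eq_fun do rewrite mxE.
have D0 : D z0 != 0 by have := gram_unit fG0; rewrite unitmxE unitfE.
exists [set t | D (row_of_tuple t) = 0]; split.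
- rewrite [X in measurable X](_ : _ = (fun t => D (row_of_tuple t)) @^-1` [set 0]) //.
  by rewrite -[X in measurable X]setTI; exact: pole_free_measurable.
- exact: pole_free_null rD D0.
- move=> t /= ; apply: contra_notP => /eqP Dt.
  have : G (row_of_tuple t) *m (G (row_of_tuple t))^T \in unitmx.
    by rewrite unitmxE unitfE.
  rewrite -row_free_unit /row_free => /eqP rk.
  rewrite eqn_leq rank_leq_row -{1}rk.
  exact: mxrankM_maxl.
Qed.

End almost_everywhere.

Section integral_choice.
Variables (R : realType) (n : nat) (lam : nat -> R).

Let al := potential lam.

Definition prefix_indicator (i a : nat) : R := (a <= i)%N%:R.

Definition kinetic_weight (i : nat) : R := if i == 0%N then 2^-1 else 0.

(** The Uhlenbeck integral of a block has the indicator of the block as potential.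
Sums over initial segments of blocks are used instead, as their differences
between consecutive blocks single out one index. If the segment ends inside a
level of [al], its indicator is not constant on levels and only the splitting
part is kept. The index [0] is reserved for the hamiltonian. *)
Definition cut_potential (i : nat) : nat -> R :=
  if [&& i != 0%N, (i < n./2)%N & al i != al i.+1] then prefix_indicator i else fun=> 0.

Definition cut_splitting (i : nat) : nat -> R :=
  if (i != 0%N) && (i < n./2)%N then prefix_indicator i else fun=> 0.

Definition rotation_weight (i a : nat) : R :=
  if i == 0%N then - lam a
  else if (i < n./2)%N then 0 else (a == i - n./2)%N%:R.

Hypothesis lamS : forall a, lam a.+1 ^+ 2 <= lam a ^+ 2.

Lemma cut_potential_levels i : constant_on_levels al (cut_potential i).
Proof.
rewrite /cut_potential; case: ifP => // /and3P[_ _ ali] a b.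
have mono := nonincreasing_levels (al := al) lamS.
wlog ab : a b / (a <= b)%N.
  by move=> W; case/orP: (leq_total a b) => [/W|/W H /esym/H].
move=> alab; rewrite /prefix_indicator; case: (leqP a i) => ai; case: (leqP b i) => bi //.
  case/negP: ali; rewrite eq_le (mono i i.+1) // andbT.
  by rewrite (le_trans (mono _ _ ai)) // alab mono.
by have := leq_trans ai (leq_trans ab bi); rewrite ltnn.
Qed.

Lemma prefix_indicator_diff i a : prefix_indicator i a - prefix_indicator i a.+1 = (a == i)%:R.
Proof.
by rewrite /prefix_indicator; case: (ltngtP a i) => _; rewrite ?subrr ?subr0.
Qed.

(** The blocks [a] and [a.+1] are separated only by the initial segment ending at
[a]. For [a = 0] this segment is replaced by the hamiltonian, whose coefficients
separate all blocks; once its weight is known to vanish, the others follow. *)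
Lemma integral_choice_independent rho mu (v : 'I_n -> R) : (2 <= n)%N -> rho != 0 ->
  integral_grad_mom al (\sum_(i < n) v i * kinetic_weight i)
    (fun a => \sum_(i < n) v i * cut_potential i a)
    (fun a => \sum_(i < n) v i * cut_splitting i a)
    (fun a => \sum_(i < n) v i * rotation_weight i a)
    (test_position (n + 1) rho) (test_momentum (n + 1) al rho mu) = 0 ->
  forall i, v i = 0.
Proof.
move=> n2 rho0; have n0 : (0 < n)%N := ltnW n2.
have half0 : (0 < n./2)%N by case: n n2 => [|[|k]].
have halfn : (n./2.*2 <= n)%N by rewrite -[leqRHS]odd_double_half leq_addl.
pose o := Ordinal n0.
set h := \sum_(i < n) _; set e := fun a => _; set e' := fun a => _; set f := fun a => _.
have le : constant_on_levels al e.
  by move=> a b ab; apply: eq_bigr => i _; rewrite (cut_potential_levels i ab).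
move=> /(momentum_gradient_kernel lamS rho0 le)[f0 cuts].
have hE : h = v o * 2^-1.
  rewrite /h (bigD1 o) //= big1 ?addr0 // => i io.
  rewrite /kinetic_weight; case: eqP => [i0|_]; last by rewrite mulr0.
  by case/eqP: io; apply: val_inj.
have splitE a : (a < n./2)%N -> e' a - e' a.+1 = if a == 0%N then 0 else
    \sum_(i < n) v i * (a == i)%:R.
  move=> an; rewrite /e' -sumrB; case: eqP => [->|/eqP a0].
    rewrite big1 // => i _; rewrite -mulrBr /cut_splitting.
    case: ifP => [/andP[i0 _]|]; last by rewrite subrr mulr0.
    by rewrite prefix_indicator_diff eq_sym (negPf i0) mulr0.
  apply: eq_bigr => i _; rewrite -mulrBr /cut_splitting.
  case: ifP => [_|ni]; first by rewrite prefix_indicator_diff.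
  rewrite subrr; case: eqP => // ai.
  by move: ni; rewrite -ai a0 an.
have potE a : (a < n./2)%N -> al a != al a.+1 -> e a - e a.+1 = if a == 0%N then 0 else
    \sum_(i < n) v i * (a == i)%:R.
  move=> an ala; rewrite /e -sumrB; case: eqP => [->|/eqP a0].
    rewrite big1 // => i _; rewrite -mulrBr /cut_potential.
    case: ifP => [/andP[i0 _]|]; last by rewrite subrr mulr0.
    by rewrite prefix_indicator_diff eq_sym (negPf i0) mulr0.
  apply: eq_bigr => i _; rewrite -mulrBr /cut_potential.
  case: ifP => [_|ni]; first by rewrite prefix_indicator_diff.
  rewrite subrr; case: eqP => // ai.
  by move: ni; rewrite -ai a0 an ala.
have inrange a : (a < n./2)%N -> (a.+1.*2 < n + 1)%N.
  by move=> an; rewrite addn1 ltnS (leq_trans _ halfn) // leq_double.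
have h0 : h = 0.
  have := cuts 0%N (inrange _ half0); rewrite splitE // /=.
  case: eqP => [_|/eqP ala]; first by rewrite addr0.
  by rewrite potE // addr0 => /eqP; rewrite mulf_eq0 subr_eq0 (negPf ala) orbF => /eqP.
have vo : v o = 0.
  by move: hE; rewrite h0 => /esym/eqP; rewrite mulf_eq0 invr_eq0 pnatr_eq0 orbF => /eqP.
have pick (a : nat) (an : (a < n)%N) : \sum_(i < n) v i * (a == i)%:R = v (Ordinal an).
  rewrite (bigD1 (Ordinal an)) //= eqxx mulr1 big1 ?addr0 // => i ia.
  case: eqP => [ai|_]; last by rewrite mulr0.
  by case/eqP: ia; apply: val_inj.
move=> i; have [i0|i0] := eqVneq (i : nat) 0%N.
  by rewrite -vo; congr v; apply: val_inj.
have [il|il] := ltnP i n./2.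
  have := cuts i (inrange _ il); rewrite splitE // h0 mul0r !add0r (negPf i0) pick.
  case: eqP => [_ <-|/eqP ali]; first by congr v; apply: val_inj.
  by rewrite potE // (negPf i0) pick => <-; congr v; apply: val_inj.
have range : ((i - n./2).*2.+1 < n + 1)%N.
  have := ltn_ord i; have := odd_double_half n; lia.
have := f0 _ range; rewrite /f (bigD1 i) //= /rotation_weight (negPf i0).
rewrite ltnNge il /= eqxx mulr1 big1 ?addr0 // => j ji.
case: eqP => [j0|/eqP j0].
  by rewrite (_ : j = o) ?vo ?mul0r //; apply: val_inj.
case: ltnP => jl; first by rewrite mulr0.
case: eqP => [ij|_]; last by rewrite mulr0.
case/eqP: ji; apply: val_inj => /=.
by rewrite -(subnK jl) -ij subnK.
Qed.

End integral_choice.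

Section choice_degree.
Variables (R : realType) (n : nat) (A Q : 'M[R]_(n + 1)) (lam : nat -> R).
Hypotheses (QQ : Q *m Q^T = 1%:M) (lamS : forall a, lam a.+1 ^+ 2 <= lam a ^+ 2).
Variable s : bool.

Let al := potential lam.

Lemma prefix_indicator_sorted i a b : (a <= b)%N ->
  prefix_indicator R i b <= prefix_indicator R i a.
Proof.
move=> ab; rewrite /prefix_indicator ler_nat; case: (leqP b i) => // bi.
by rewrite (leq_trans ab bi).
Qed.

Lemma cut_quotient_ge0 i a b : 0 <=
  two_level_quotient al (cut_potential n lam i) (cut_splitting R n i) a b.
Proof.
wlog ab : a b / (a <= b)%N.
  by move=> W; case/orP: (leq_total a b) => [/W//|/W]; rewrite two_level_quotientC.
rewrite /two_level_quotient; case: eqP => [_|_]; apply: divr_ge0; rewrite subr_ge0.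
- by rewrite /cut_splitting; case: ifP => // _; exact: prefix_indicator_sorted.
- by rewrite ler_nat.
- by rewrite /cut_potential; case: ifP => // _; exact: prefix_indicator_sorted.
- exact: nonincreasing_levels lamS _ _ ab.
Qed.

Lemma cut_quotient_gt0 i : i != 0%N -> (i < n./2)%N -> 0 <
  two_level_quotient al (cut_potential n lam i) (cut_splitting R n i) i i.+1.
Proof.
move=> i0 il; rewrite /two_level_quotient /cut_potential /cut_splitting i0 il /=.
rewrite -/al; case: eqP => [_|/eqP ali].
  by rewrite prefix_indicator_diff eqxx -natr1 addrAC subrr add0r divr1 ltr01.
rewrite prefix_indicator_diff eqxx divr_gt0 ?ltr01 // subr_gt0 lt_def ali.
exact: lamS.
Qed.

Let F (i : nat) (z : 'rV[R]_(n + n)) := magnetic_integral al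
  (kinetic_weight R i) (cut_potential n lam i) (cut_splitting R n i)
  (rotation_weight n lam i)
  (position Q (cotangent_chart s z)) (momentum A Q (cotangent_chart s z)).

(** The quadratic part is a sum of squared rotations with nonnegative
coefficients, and the rotation in the first coordinates of blocks [i] and [i + 1]
has a positive one. *)
Lemma choice_quadratic (i : nat) : (i < n./2)%N -> quadratic_in_momenta (F i).
Proof.
move=> il; have [u [rho [mu [rho0 Xu XY]]]] := exists_test_chart al QQ s.
have [|p pE] := fibre_momentum_onto QQ
    (b := test_momentum (n + 1) al rho mu) (u := u) (s := s).
  by rewrite Xu.
apply: (@quadratic_of_difference _ _ _ u p).
  apply: quadraticD; first exact: quadratic_quad_integral.
  by apply: quadratic_affine; exact: affine_lin_integral.
pose c := @pair_coef R (n + 1) al (kinetic_weight R i) (cut_potential n lam i)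
  (cut_splitting R n i).
have -> : F i (row_mx u p) + F i (row_mx u (- p)) - 2 * F i (row_mx u 0) =
    \sum_k \sum_l c k l *
      rotation (test_position (n + 1) rho) (test_momentum (n + 1) al rho mu) k l ^+ 2.
  rewrite -Xu -pE -(quad_integral_difference A Q s _
    (potential_coef al (kinetic_weight R i) (cut_potential n lam i)) u p).
  rewrite /F /magnetic_integral.
  rewrite /lin_integral !position_row !momentum_row /fibre_momentum !mul0mx !mulNmx.
  rewrite !dotmulDr dotmulNr dotmul0.
  move: (quad_integral _ _ _ _) (quad_integral _ _ _ _) (quad_integral _ _ _ _).
  by move: (dotmul _ _) (dotmul _ _) => *; ring.
have c_ge0 k l : 0 <= c k l.
  rewrite addr_ge0 ?cut_quotient_ge0 //.
  by rewrite /kinetic_weight; case: ifP; rewrite ?invr_ge0 ?ler0n.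
have iN : (i.+1.*2 < n + 1)%N.
  by have := odd_double_half n; have := il; clear; lia.
have iN' : (i.*2 < n + 1)%N by rewrite (leq_trans _ iN) // ltnS leq_double.
pose k := Ordinal iN'; pose l := Ordinal iN.
have k2 : k./2 = i := doubleK i.
have l2 : l./2 = i.+1 := doubleK i.+1.
rewrite gt_eqF // (bigD1 k) //= ltr_pwDl //; last first.
  by apply: sumr_ge0 => a _; apply: sumr_ge0 => b _; rewrite mulr_ge0 ?sqr_ge0.
rewrite (bigD1 l) //= ltr_pwDl //; last first.
  by apply: sumr_ge0 => b _; rewrite mulr_ge0 ?sqr_ge0.
rewrite mulr_gt0 //.
  rewrite /c /pair_coef k2 l2 /kinetic_weight.
  case: eqP => [i0|/eqP i0]; last by rewrite add0r; exact: cut_quotient_gt0.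
  by rewrite ltr_pwDl ?invr_gt0 ?ltr0n // cut_quotient_ge0.
rewrite rotation_test k2 l2 /= odd_double /= !mulr1.
rewrite exprn_even_gt0 //= mulf_neq0 ?expf_neq0 //.
rewrite gt_eqF // subr_gt0 /tilt -natr1.
by have := lamS i; rewrite -/(potential lam i) -/(potential lam i.+1) -/al => H; lra.
Qed.

(** At the test point, the momentum along the odd coordinate of the rotation plane
makes the linear part nonzero. *)
Lemma choice_linear (i : nat) : (n./2 <= i < n)%N -> (2 <= n)%N ->
  linear_in_momenta (F i).
Proof.
move=> /andP[il iltn] n2; have [u [rho [mu [rho0 Xu XY]]]] := exists_test_chart al QQ s.
have iN : ((i - n./2).*2.+1 < n + 1)%N.
  by have := odd_double_half n; have := il; have := iltn; clear; lia.
have i0 : (i == 0%N) = false.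
  by apply/negP => /eqP i0; move: il; rewrite i0 leqn0; case: n n2 => [|[|m]].
have {}il : (i < n./2)%N = false by rewrite ltnNge il.
pose k := Ordinal iN.
have [|p pE] := fibre_momentum_onto QQ (b := delta_mx 0 k) (u := u) (s := s).
  rewrite Xu dotmulE big1 // => j _; rewrite !mxE eqxx /=.
  by case: eqP => [->|_] /=; rewrite ?odd_double /= ?mulr0 ?mul0r.
have FE : F i = fun z => lin_integral (block_rotation (n + 1) (rotation_weight n lam i))
    (position Q (cotangent_chart s z)) (momentum A Q (cotangent_chart s z)).
  apply/funext => z; rewrite /F /magnetic_integral /quad_integral.
  rewrite /kinetic_weight /cut_potential /cut_splitting i0 il /=.
  rewrite [X in 2^-1 * X]big1 ?mulr0 ?add0r => [|a _]; last first.
    rewrite big1 // => b _; rewrite /pair_coef /two_level_quotient !subrr !mul0r.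
    by rewrite if_same addr0 mul0r.
  by rewrite big1 ?add0r // => a _; rewrite /potential_coef mul0r addr0 mul0r.
rewrite FE; apply: (@linear_of_difference _ _ _ u p); first exact: affine_lin_integral.
rewrite lin_integral_difference pE Xu.
have ok : odd k by rewrite /= odd_double.
have k2 : k./2 = (i - n./2)%N := uphalf_double _.
rewrite /dotmul trmx_delta -colE mxE test_position_rotation // k2 mulf_neq0 //.
by rewrite /rotation_weight i0 il eqxx oner_neq0.
Qed.

End choice_degree.

Theorem theorem1p1 (R : realType) (n : nat) (hn : (2 <= n)%N)
    (A : 'M[R]_(n + 1)) (hA : A^T = - A) :
  exists F : 'I_n -> cotangent_sphere R n -> R,
    (forall i s, smooth (in_chart (F i) s)) /\
    (forall i s z, poisson A s (hamiltonian s) (in_chart (F i) s) z = 0) /\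
    (exists c : 'I_n -> R, forall s z,
       hamiltonian s z = \sum_i c i * in_chart (F i) s z) /\
    (forall i j s z,
       poisson A s (in_chart (F i) s) (in_chart (F j) s) z = 0) /\
    (forall s, {ae lebesgue_tuple R (n + n), forall t,
       row_free (\matrix_(i < n) gradient (in_chart (F i) s) (row_of_tuple t))}) /\
    (forall (i : 'I_n) s,
       if (i < n./2)%N then quadratic_in_momenta (in_chart (F i) s)
       else linear_in_momenta (in_chart (F i) s)).
Proof.
have [Q [lam [QQ normal eigen lamS]]] := skew_normal_form hA.
pose al := potential lam.
have normal' : Q *m A *m Q^T = block_rotation (n + 1) lam.
  by apply/matrixP => i j; rewrite normal mxE.
pose h (i : 'I_n) : R := kinetic_weight R i.
pose e (i : 'I_n) := cut_potential n lam i.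
pose e' (i : 'I_n) := cut_splitting R n i.
pose f (i : 'I_n) := rotation_weight n lam i.
have le i : constant_on_levels al (e i) by exact: cut_potential_levels.
pose F (i : 'I_n) (c : cotangent_sphere R n) :=
  magnetic_integral al (h i) (e i) (e' i) (f i) (position Q c) (momentum A Q c).
pose o := Ordinal (ltnW hn).
have F0 : F o = kinetic_energy (n := n).
  apply/funext => c; rewrite (kinetic_energy_integral hA QQ normal' eigen) /F.
  rewrite /h /e /e' /f /kinetic_weight /cut_potential /cut_splitting /=.
  by congr (magnetic_integral _ _ _ _ _ _ _); apply/funext => a.
have hamF s : hamiltonian s = in_chart (F o) s by rewrite hamiltonianE F0.
have rF i s : pole_free (in_chart (F i) s) by exact: pole_free_integral.
have comm i j s z : poisson A s (in_chart (F i) s) (in_chart (F j) s) z = 0.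
  exact: (poisson_integral A QQ s h e' f le).
exists F; split; first by move=> i s; exact: pole_free_smooth.
split; first by move=> i s z; rewrite hamF.
split.
  exists (fun i => (i == o)%:R) => s z; rewrite hamF (bigD1 o) //= ?eqxx mul1r.
  by rewrite big1 ?addr0 // => i /negPf ->; rewrite mul0r.
split=> //.
split=> [s|i s].
  have [u [rho [mu [rho0 Xu XY]]]] := exists_test_chart al QQ s.
  apply: (pole_free_row_free_ae
    (G := fun z => \matrix_(i < n) gradient (in_chart (F i) s) z)).
    move=> i j; under eq_fun do rewrite !mxE; exact: pole_free_derive.
  have [|p pE] := fibre_momentum_onto QQ
      (b := test_momentum (n + 1) al rho mu - stereo s u *m A *m Q^T) (u := u) (s := s).
    by rewrite dotmulDr Xu XY add0r -Xu dotmulNr dotmul_rot // skew_dot0 // oppr0.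
  exists (row_mx u p); apply: row_free_gradient => // v.
  rewrite position_row momentum_row pE Xu subrK.
  exact: integral_choice_independent.
case: ifPn => il; first exact: (choice_quadratic A QQ lamS s il).
by apply: (choice_linear A lam QQ s) => //; rewrite leqNgt il /=.
Qed.
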